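(* Let $\Bbbk$ be a field and let $G$ be a connected cograph that is not complete. Let $G_1,\dots,G_m$ be the complements of the connected components of the complement $\overline{G}$, so that $G=G_1\ast\dots\ast G_m$; the $G_i$ are cographs each of which is either disconnected or a single vertex. Then $$\operatorname{reg}(S/J_G)=\max\bigl(\{2\}\cup\{\operatorname{reg}(S/J_{G_i}) : i\in\{1,\dots,m\}\}\bigr).$$
   Context: All graphs are finite, simple and undirected, with nonempty vertex set. A cograph (complement reducible graph) is a graph having no induced subgraph that is a path on $4$ vertices. The complement $\overline{G}$ of $G$ has the same vertex set as $G$, and two distinct vertices are adjacent in $\overline{G}$ if and only if they are not adjacent in $G$. The join of two graphs $G$ and $H$ is $G\ast H=(V(G)\sqcup V(H),\ E(G)\cup E(H)\cup\{\{v,w\}: v\in V(G), w\in V(H)\})$; it is associative. For a graph $G$ with vertex set $[n]=\{1,\dots,n\}$ and edge set $E$, let $S=\Bbbk[x_1,\dots,x_n,y_1,\dots,y_n]$ be the standard graded polynomial ring over the field $\Bbbk$; the binomial edge ideal of $G$ is $J_G=\langle x_iy_j-y_ix_j : \{i,j\}\in E\rangle\subseteq S$ (for a graph on another vertex set, use variables indexed by that vertex set; enlarging the ambient polynomial ring by extra variables does not change the regularity). The graded Betti numbers are $\beta_{i,j}(S/J_G)=\dim_\Bbbk \operatorname{Tor}_i^S(S/J_G,\Bbbk)_j$, and the Castelnuovo--Mumford regularity is $\operatorname{reg}(S/J_G)=\max\{j-i : \beta_{i,j}(S/J_G)\neq 0\}$. *)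

(* Defs.v *)
From HB Require Import structures.
From mathcomp Require Import all_boot all_order all_algebra.

Set Implicit Arguments.
Unset Strict Implicit.
Unset Printing Implicit Defensive.

Import GRing.Theory.
Local Open Scope ring_scope.

(** * Graphs *)

Record sgraph := SGraph {
  vertex :> finType;
  edge : rel vertex;
  edge_sym : symmetric edge;
  edge_irr : irreflexive edge }.

Arguments edge {s}.

Lemma compl_sym (G : sgraph) :
  symmetric [rel u v : G | (u != v) && ~~ edge u v].
Proof. by move=> u v /=; rewrite eq_sym edge_sym. Qed.

Lemma compl_irr (G : sgraph) :
  irreflexive [rel u v : G | (u != v) && ~~ edge u v].
Proof. by move=> u /=; rewrite eqxx. Qed.

Definition compl (G : sgraph) : sgraph :=
  SGraph (@compl_sym G) (@compl_irr G).

Lemma induced_sym (G : sgraph) (A : {set G}) :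
  symmetric [rel u v : {x : G | x \in A} | edge (val u) (val v)].
Proof. by move=> u v /=; rewrite edge_sym. Qed.

Lemma induced_irr (G : sgraph) (A : {set G}) :
  irreflexive [rel u v : {x : G | x \in A} | edge (val u) (val v)].
Proof. by move=> u /=; rewrite edge_irr. Qed.

Definition induced (G : sgraph) (A : {set G}) : sgraph :=
  SGraph (@induced_sym G A) (@induced_irr G A).

(* The join of a finite family of graphs: the vertex set is the disjoint union,
   and vertices of different members of the family are always adjacent. *)
Section Join.
Variables (I : finType) (H : I -> sgraph).

Definition join_vertex : finType := {i : I & H i}.

Definition join_edge : rel join_vertex :=
  fun u v => (tag u != tag v) || edge (tagged u) (tagged_as u v).

Lemma join_sym : symmetric join_edge.
Proof.
move=> [i x] [j y]; rewrite /join_edge /= eq_sym.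
have [eq_ij | //] := eqVneq j i; move: y; rewrite eq_ij => y.
by rewrite !tagged_asE edge_sym.
Qed.

Lemma join_irr : irreflexive join_edge.
Proof. by move=> [i x]; rewrite /join_edge /= eqxx tagged_asE edge_irr. Qed.

Definition join : sgraph := SGraph join_sym join_irr.
End Join.

Definition isomorphic (G H : sgraph) : Prop :=
  exists f : G -> H, bijective f /\ forall u v, edge (f u) (f v) = edge u v.

Definition connected (G : sgraph) : Prop :=
  (0 < #|G|)%N /\ forall u v : G, connect edge u v.

Definition complete (G : sgraph) : Prop :=
  forall u v : G, u != v -> edge u v.

Definition cograph (G : sgraph) : Prop :=
  ~ exists f : 'I_4 -> G, injective f /\
      forall i j : 'I_4, edge (f i) (f j) = (i.+1 == j) || (j.+1 == i).

Definition components (G : sgraph) : {set {set G}} :=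
  equivalence_partition (connect edge) [set: G].

Definition component (G : sgraph) : finType :=
  {C : {set G} | C \in components G}.

Definition join_factor (G : sgraph) (C : component (compl G)) : sgraph :=
  compl (induced (val C)).

(** * Binomial edge ideals *)

(* Imported only here because mpoly redefines [symmetric]. *)
From mathcomp.multinomials Require Import mpoly.

(* The variable x_v of the text is numbered by the rank of v, and y_v by
   #|G| plus this rank. *)
Section BinomialEdgeIdeal.
Variables (k : fieldType) (G : sgraph).

Definition bei_ring := {mpoly k[#|G| + #|G|]}.

Definition xvar (v : G) : bei_ring := 'X_(lshift #|G| (enum_rank v)).
Definition yvar (v : G) : bei_ring := 'X_(rshift #|G| (enum_rank v)).

Definition bei (p : bei_ring) : Prop :=
  exists c : G * G -> bei_ring,
    p = \sum_(uv : G * G | edge uv.1 uv.2)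
          c uv * (xvar uv.1 * yvar uv.2 - yvar uv.1 * xvar uv.2).
End BinomialEdgeIdeal.

(** * Tor, graded Betti numbers and regularity *)

(* A sequence ... -> F_2 -> F_1 -> F_0 of graded free modules of finite rank
   over S = k[X_0, ..., X_(N-1)]: F_i has a basis whose a-th element has degree
   [shift i a], so that F_i is the direct sum of the S(- shift i a). Elements
   of F_i are row vectors, and the differential F_(i+1) -> F_i is right
   multiplication by [diff i]. *)
Record free_seq (k : fieldType) (N : nat) := FreeSeq {
  frank : nat -> nat;
  shift : forall i, 'I_(frank i) -> nat;
  diff : forall i, 'M[{mpoly k[N]}]_(frank i.+1, frank i) }.

Section Tor.
Variables (k : fieldType) (N : nat).
Local Notation S := {mpoly k[N]}.

(* The elements of degree j in the direct sum of the S(- d a). *)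
Definition in_degree (r : nat) (d : 'I_r -> nat) (j : nat) (v : 'rV[S]_r) :
    Prop :=
  forall a, if (d a <= j)%N then v 0 a \is (j - d a)%N.-homog else v 0 a == 0.

(* An S-linear map F_0 -> k, where S acts on k through S -> S / (X_0, ...),
   is determined by the images [eps a] of the basis elements. *)
Definition augmentation (r : nat) (eps : 'I_r -> k) (v : 'rV[S]_r) : k :=
  \sum_a eps a * (v 0 a)@_0%MM.

(* F is a graded free resolution of the residue field k = S / (X_0, ...),
   placed in degree 0. *)
Definition resolves_k (F : free_seq k N) : Prop :=
  [/\ forall i a, in_degree (@shift _ _ F i) (shift a) (row a (diff F i)),
      exists eps : 'I_(frank F 0) -> k,
        [/\ forall a, eps a != 0 -> shift a = 0%N,
            forall c : k, exists v, augmentation eps v = c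
          & forall v, augmentation eps v = 0 <-> exists w, v = w *m diff F 0]
    & forall i (v : 'rV[S]_(frank F i.+1)),
        v *m diff F i = 0 <-> exists w, v = w *m diff F i.+1].

(* Representatives in F_i of the i-cycles and of the i-boundaries, in degree j,
   of the complex S/J (x) F; here (S/J (x) F_i)_j = (F_i)_j / (J F_i)_j for a
   homogeneous ideal J. *)
Definition tor_cycle (J : S -> Prop) (F : free_seq k N) (i j : nat)
    (v : 'rV[S]_(frank F i)) : Prop :=
  in_degree (@shift _ _ F i) j v /\
  match i return 'rV[S]_(frank F i) -> Prop with
  | 0 => fun _ => True
  | i'.+1 => fun v => forall b, J ((v *m diff F i') 0 b)
  end v.

Definition tor_boundary (J : S -> Prop) (F : free_seq k N) (i j : nat)
    (v : 'rV[S]_(frank F i)) : Prop :=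
  in_degree (@shift _ _ F i) j v /\
  exists w : 'rV[S]_(frank F i.+1),
    in_degree (@shift _ _ F i.+1) j w /\
    forall b, J ((v - w *m diff F i) 0 b).

(* The k-vector space Z / B has dimension n. *)
Definition quotient_dim (r : nat) (Z B : 'rV[S]_r -> Prop) (n : nat) : Prop :=
  exists z : 'I_n -> 'rV[S]_r,
    [/\ forall l, Z (z l),
        forall c : 'I_n -> k,
          B (\sum_l (c l)%:MP *: z l) -> forall l, c l = 0
      & forall v, Z v -> exists c : 'I_n -> k,
          B (v - \sum_l (c l)%:MP *: z l)].

(* beta_(i,j)(S/J) = dim_k Tor_i(S/J, k)_j is n, where Tor is computed with the
   resolution F of k. *)
Definition betti (J : S -> Prop) (F : free_seq k N) (i j n : nat) : Prop :=
  quotient_dim (@tor_cycle J F i j) (@tor_boundary J F i j) n.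

(* reg(S/J) = r. Tor does not depend on the choice of F. *)
Definition regularity (J : S -> Prop) (r : nat) : Prop :=
  exists F : free_seq k N,
    [/\ resolves_k F,
        exists i j n, [/\ betti J F i j n, n != 0%N & j = (i + r)%N]
      & forall i j n, betti J F i j n -> n != 0%N -> (j <= i + r)%N].

End Tor.

(* reg(S/J_G) = r *)
Definition reg_bei (k : fieldType) (G : sgraph) (r : nat) : Prop :=
  regularity (@bei k G) r.

(* Main.v *)
Require Import Defs.
From Stdlib Require Import Classical ClassicalEpsilon.
From Stdlib Require Import FunctionalExtensionality PropExtensionality.
From mathcomp Require Import all_boot all_order all_algebra ring.
From mathcomp.multinomials Require Import mpoly.

Set Implicit Arguments.
Unset Strict Implicit.
Unset Printing Implicit Defensive.

Import Order.TTheory GRing.Theory.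
Local Open Scope ring_scope.

(* Tor is computed with the Koszul complex on the variables, and the regularity
   is finite because the Koszul cycles form a finitely generated module.

   Upper bound: let e be a graph in which every vertex outside the factor G_i is
   adjacent to all of G_i, and complete it to e' on the vertices of G_i. Then
   J_e' / J_e is annihilated by the variables of the vertices outside G_i, and
   it comes from the quotient of the clique ideal by J_(G_i) in the polynomial
   ring of G_i, whose homology is controlled by that of S / J_(G_i) and by
   reg <= 1 for cliques. Completing the factors one after the other reduces to
   the complete graph.

   Lower bound: restriction to an induced subgraph is a retraction, so that
   reg (S / J_(G_i)) <= reg (S / J_G), and an induced path u w v carries the
   Koszul class f_uv dx_w dy_w, which does not vanish. *)

(** * Koszul complexes *)

(** Everything is stated strand by strand: strand [e] in homological degree [i] is the internal
    degree [i + e + 1], and the regularity is at most [r] when all strands [e >= r] vanish.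
    Coefficients are quotients [A/B] of graded families of subgroups of the polynomial ring, so that
    long exact sequences become short diagram chases on row vectors. The constant 2 comes from a
    connecting map. The quotient of the clique ideal by [J_(G_i)] is the kernel of the map from
    [S / J_(G_i)] to the quotient by the clique ideal; the connecting map lowers the homological
    degree by 1 and so raises the strand by 1. Cliques vanish from strand 1 on, hence this kernel is
    controlled only from strand 2 on. The Koszul complex depends on an order of the variables,
    whereas each step wants the variables outside one factor in front. Complexes are therefore
    compared by matrices that preserve every subgroup of coefficients, and so every degree and every
    ideal. That each factor is disconnected or a single vertex is Seinsche's theorem, proved
    separately by deleting vertices. *)

Section Rows.
Variable R : comNzRingType.
Implicit Types (A B : R -> Prop).

Definition subgroup A := A 0 /\ forall p q, A p -> A q -> A (p - q).

Definition inrow A m (v : 'rV[R]_m) := forall j, A (v 0 j).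

Lemma subgroupN A p : subgroup A -> A p -> A (- p).
Proof. by case=> A0 AB Ap; rewrite -sub0r; apply: AB. Qed.

Lemma subgroupD A p q : subgroup A -> A p -> A q -> A (p + q).
Proof. by move=> sA Ap Aq; rewrite -[q]opprK; apply: sA.2 => //; apply: subgroupN. Qed.

Lemma subgroup_sum A (I : Type) (r : seq I) (P : pred I) (F : I -> R) :
  subgroup A -> (forall i, P i -> A (F i)) -> A (\sum_(i <- r | P i) F i).
Proof.
by move=> sA AF; apply: big_ind => [|p q|]; [apply: sA.1 | apply: subgroupD |].
Qed.

Lemma inrowB A m (v w : 'rV_m) :
  subgroup A -> inrow A v -> inrow A w -> inrow A (v - w).
Proof. by move=> sA Av Aw j; rewrite !mxE; apply: sA.2. Qed.

Lemma inrowN A m (v : 'rV_m) : subgroup A -> inrow A v -> inrow A (- v).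
Proof. by move=> sA Av j; rewrite !mxE; apply: subgroupN. Qed.

Lemma inrowD A m (v w : 'rV_m) :
  subgroup A -> inrow A v -> inrow A w -> inrow A (v + w).
Proof. by move=> sA Av Aw j; rewrite !mxE; apply: subgroupD. Qed.

Lemma inrow0 A m : subgroup A -> inrow A (0 : 'rV_m).
Proof. by move=> sA j; rewrite !mxE; apply: sA.1. Qed.

Lemma inrowS A B m (v : 'rV_m) :
  (forall p, A p -> B p) -> inrow A v -> inrow B v.
Proof. by move=> sAB Av j; apply: sAB. Qed.

Lemma inrowZ A B m (z : R) (v : 'rV_m) :
  (forall p, A p -> B (z * p)) -> inrow A v -> inrow B (z *: v).
Proof. by move=> zAB Av j; rewrite !mxE; apply: zAB. Qed.

Lemma inrow_row_mx A m n (v : 'rV_m) (w : 'rV_n) :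
  inrow A (row_mx v w) <-> inrow A v /\ inrow A w.
Proof.
split=> [Avw | [Av Aw] j].
  by split=> j; [have := Avw (lshift n j) | have := Avw (rshift m j)];
     rewrite ?row_mxEl ?row_mxEr.
by rewrite -(splitK j); case: split => i /=; rewrite ?row_mxEl ?row_mxEr.
Qed.

(* [pres M] holds in particular when the entries of M are integers. *)
Definition pres m n (M : 'M[R]_(m, n)) :=
  forall A, subgroup A -> forall v : 'rV_m, inrow A v -> inrow A (v *m M).

Lemma pres0 m n : pres (0 : 'M_(m, n)).
Proof. by move=> A sA v _; rewrite mulmx0; apply: inrow0. Qed.

Lemma pres1 m : pres (1%:M : 'M_m).
Proof. by move=> A sA v; rewrite mulmx1. Qed.

Lemma presN m n (M : 'M_(m, n)) : pres M -> pres (- M).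
Proof. by move=> pM A sA v Av; rewrite mulmxN; apply: inrowN (pM A sA v Av). Qed.

Lemma presM m n p (M : 'M_(m, n)) (P : 'M_(n, p)) :
  pres M -> pres P -> pres (M *m P).
Proof. by move=> pM pP A sA v Av; rewrite mulmxA; exact: pP _ sA _ (pM _ sA _ Av). Qed.

Lemma pres_block m1 m2 n1 n2 (Mul : 'M_(m1, n1)) (Mur : 'M_(m1, n2))
    (Mdl : 'M_(m2, n1)) (Mdr : 'M_(m2, n2)) :
  pres Mul -> pres Mur -> pres Mdl -> pres Mdr ->
  pres (block_mx Mul Mur Mdl Mdr).
Proof.
move=> pul pur pdl pdr A sA v; rewrite -[v]hsubmxK => /inrow_row_mx[Al Ar].
rewrite mul_row_block; apply/inrow_row_mx.
by split; apply: inrowD => //;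
   [exact: (pul A sA) | exact: (pdl A sA) | exact: (pur A sA) | exact: (pdr A sA)].
Qed.
End Rows.

(* The index is the homological degree plus 1, so that index 0 stands for the
   zero module in degree -1. *)
Fixpoint krank n i :=
  if i is i'.+1 then if n is n'.+1 then (krank n' i'.+1 + krank n' i')%N
                     else (i' == 0)%N : nat
  else 0%N.

Lemma krank0 n : krank n 0 = 0%N.
Proof. by case: n. Qed.

Lemma krank1 n : krank n 1 = 1%N.
Proof. by elim: n => //= n ->; rewrite krank0. Qed.

Lemma krank_gt n i : (n.+1 < i)%N -> krank n i = 0%N.
Proof.
elim: n i => [|n IHn] [|i] //= lt_ni; first by case: i lt_ni.
by rewrite !IHn // ltnW.
Qed.

Lemma rV_thin (R : nmodType) m (v w : 'rV[R]_m) : m = 0%N -> v = w.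
Proof. by move=> m0; move: v w; rewrite m0 => v w; apply/rowP; case. Qed.

Section Koszul.
Variable R : comNzRingType.
Implicit Types (s t : seq R) (z : R).

Local Notation kr s i := (krank (size s) i).

Fixpoint kdiff_fun n (f : nat -> R) i : 'M[R]_(krank n i.+1, krank n i) :=
  match n return 'M[R]_(krank n i.+1, krank n i) with
  | 0 => 0
  | n'.+1 =>
    match i return 'M[R]_(krank n'.+1 i.+1, krank n'.+1 i) with
    | 0 => 0
    | i'.+1 =>
      let g j := f j.+1 in
      block_mx (kdiff_fun n' g i'.+1) 0 (f 0%N)%:M (- kdiff_fun n' g i')
    end
  end.

Definition kdiff s := kdiff_fun (size s) (nth 0 s).

Lemma kdiff_block z s i : kdiff (z :: s) i.+1 =
  block_mx (kdiff s i.+1) 0 z%:M (- kdiff s i).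
Proof. by []. Qed.

Lemma kdiff_cons z s i (a : 'rV_(kr s i.+2)) (b : 'rV_(kr s i.+1)) :
  row_mx a b *m kdiff (z :: s) i.+1 =
  row_mx (a *m kdiff s i.+1 + z *: b) (- (b *m kdiff s i)).
Proof. by rewrite mul_row_block mulmx0 add0r mulmxN -mul_mx_scalar. Qed.

Lemma kdiff0 s : kdiff s 0 = 0.
Proof. by case: s. Qed.

Lemma eq_kdiff n f g i : f =1 g -> kdiff_fun n f i = kdiff_fun n g i.
Proof.
elim: n f g i => [|n IHn] f g [|i] //= fg.
by rewrite fg !(IHn _ (fun j => g j.+1)) // => j; rewrite fg.
Qed.

Lemma kdiffK s i : kdiff s i.+1 *m kdiff s i = 0.
Proof.
elim: s i => [|z s IHs] [|i]; rewrite ?mul0mx //; first by rewrite kdiff0 mulmx0.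
rewrite [LHS]mulmx_block !(IHs, mul0mx, mulmx0, mulNmx, mulmxN, opprK, oppr0, addr0, add0r).
rewrite scalar_mxC subrr.
by rewrite -[RHS]submxK; congr block_mx; apply/matrixP => a b; rewrite !mxE.
Qed.
End Koszul.

(** * Homotopies and reordering of the elements of a Koszul complex *)

Section Reordering.
Variable R : comNzRingType.
Implicit Types (s t : seq R) (z : R).

Local Notation kr s i := (krank (size s) i).

Lemma mx_thin m n (M P : 'M[R]_(m, n)) : m = 0%N -> M = P.
Proof. by move=> m0; move: M P; rewrite m0 => M P; apply/matrixP; case. Qed.

(** Exterior multiplication by the basis element of [z] is a homotopy from multiplication by [z] to
    0; in particular every member of [s] annihilates the Koszul homology. *)
Lemma kdiff_homotopy s z : z \in s ->
  exists h : forall i, 'M[R]_(kr s i, kr s i.+1),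
    (forall i, pres (h i)) /\
    forall i, h i.+1 *m kdiff s i.+1 + kdiff s i *m h i = z%:M.
Proof.
elim: s => // y s IHs; rewrite inE; case: eqVneq => [-> _ | _ /IHs[h [hp hE]]].
  exists (fun i => match i return 'M_(kr (y :: s) i, kr (y :: s) i.+1) with
    0 => 0 | i'.+1 => block_mx 0 1%:M 0 0 end).
  split=> [[|i] | [|i]]; first exact: pres0.
  - by apply: pres_block; try exact: pres0; apply: pres1.
  - rewrite mulmx0 addr0 kdiff_block [LHS]mulmx_block.
    have -> : y%:M = block_mx y%:M 0 0 y%:M :> 'M_(kr s 1 + kr s 0).
      exact: scalar_mx_block.
    rewrite !(mul0mx, mulmx0, mul1mx, addr0, add0r) kdiff0 oppr0.
    by congr block_mx; apply: mx_thin (krank0 _).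
  - rewrite !kdiff_block [X in X + _]mulmx_block [X in _ + X]mulmx_block.
    rewrite !(mul0mx, mulmx0, mul1mx, mulmx1, addr0, add0r).
    by rewrite [LHS]add_block_mx !(addr0, add0r) addNr -scalar_mx_block.
exists (fun i => match i return 'M_(kr (y :: s) i, kr (y :: s) i.+1) with
  0 => 0 | i'.+1 => block_mx (h i'.+1) 0 0 (- h i') end).
split=> [[|i] | [|i]]; first exact: pres0.
- by apply: pres_block; try exact: pres0; [|apply: presN].
- rewrite mulmx0 addr0 kdiff_block [LHS]mulmx_block.
  have -> : z%:M = block_mx z%:M 0 0 z%:M :> 'M_(kr s 1 + kr s 0).
    exact: scalar_mx_block.
  rewrite !(mul0mx, mulmx0, mulNmx, addr0, add0r).
  have := hE 0%N; rewrite kdiff0 mul0mx addr0 => ->.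
  by congr block_mx; apply: mx_thin (krank0 _).
- rewrite !kdiff_block [X in X + _]mulmx_block [X in _ + X]mulmx_block.
  rewrite !(mul0mx, mulmx0, mulNmx, mulmxN, opprK, addr0, add0r).
  rewrite [LHS]add_block_mx !hE.
  by rewrite -scalar_mxC addNr addr0 -scalar_mx_block.
Qed.

(* [kdom s t]: the Koszul complex of t is a retract of that of s, by maps that
   preserve every subgroup of coefficients. *)
Definition kdom s t :=
  exists (P : forall i, 'M[R]_(kr s i, kr t i))
         (Q : forall i, 'M[R]_(kr t i, kr s i)),
  [/\ forall i, pres (P i) /\ pres (Q i),
      forall i, kdiff s i *m P i = P i.+1 *m kdiff t i,
      forall i, kdiff t i *m Q i = Q i.+1 *m kdiff s i
    & forall i, Q i *m P i = 1%:M].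

Lemma kdom_refl s : kdom s s.
Proof.
exists (fun _ => 1%:M), (fun _ => 1%:M).
by split=> i; rewrite ?mulmx1 ?mul1mx //; split; apply: pres1.
Qed.

Lemma kdom_trans s t u : kdom s t -> kdom t u -> kdom s u.
Proof.
move=> [P [Q [pPQ cP cQ PQ]]] [P' [Q' [pPQ' cP' cQ' PQ']]].
exists (fun i => P i *m P' i), (fun i => Q' i *m Q i); split=> i.
- by split; apply: presM; [case: (pPQ i)|case: (pPQ' i)|case: (pPQ' i)|case: (pPQ i)].
- by rewrite mulmxA cP -!mulmxA cP'.
- by rewrite mulmxA cQ' -!mulmxA cQ.
- by rewrite -mulmxA [Q i *m _]mulmxA PQ mul1mx.
Qed.

Lemma kdom_skip z s t : kdom s t -> kdom (z :: s) (z :: t).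
Proof.
move=> [P [Q [pPQ cP cQ PQ]]].
exists (fun i => match i return 'M_(kr (z :: s) i, kr (z :: t) i) with
  0 => 0 | i'.+1 => block_mx (P i'.+1) 0 0 (P i') end).
exists (fun i => match i return 'M_(kr (z :: t) i, kr (z :: s) i) with
  0 => 0 | i'.+1 => block_mx (Q i'.+1) 0 0 (Q i') end).
split=> [[|i]|[|i]|[|i]|[|i]]; try by apply: mx_thin.
- by split; apply: pres0.
- by split; apply: pres_block; try apply: pres0; case: (pPQ i); case: (pPQ i.+1).
- by rewrite kdiff0 mul0mx mulmx0.
- rewrite !kdiff_block [LHS]mulmx_block [RHS]mulmx_block.
  rewrite !(mul0mx, mulmx0, mulNmx, mulmxN, addr0, add0r) !cP.
  by rewrite mul_scalar_mx mul_mx_scalar.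
- by rewrite kdiff0 mul0mx mulmx0.
- rewrite !kdiff_block [LHS]mulmx_block [RHS]mulmx_block.
  rewrite !(mul0mx, mulmx0, mulNmx, mulmxN, addr0, add0r) !cQ.
  by rewrite mul_scalar_mx mul_mx_scalar.
- rewrite [LHS]mulmx_block !(mul0mx, mulmx0, addr0, add0r) !PQ.
  by rewrite -scalar_mx_block.
Qed.

(** The four blocks are the basis elements containing neither of the two leading elements, one of
    them, the other, or both. The isomorphism exchanges the two middle blocks and changes the sign
    of the last. Index 0 is the zero module, and at index 1 only the first block is nonempty; hence
    the separate cases. *)
Definition kswap_mx n i : 'M[R]_(krank n.+2 i) :=
  match i return 'M[R]_(krank n.+2 i) with
  | 0 => 0
  | 1 => block_mx 1%:M 0 0 0
  | i'.+2 =>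
    block_mx (block_mx 1%:M 0 0 0 : 'M_(krank n i'.+2 + krank n i'.+1))
             (block_mx 0 0 1%:M 0 : 'M_(krank n i'.+2 + krank n i'.+1, krank n i'.+1 + krank n i'))
             (block_mx 0 1%:M 0 0 : 'M_(krank n i'.+1 + krank n i', krank n i'.+2 + krank n i'.+1))
             (block_mx 0 0 0 (- 1%:M) : 'M_(krank n i'.+1 + krank n i'))
  end.

Lemma kdom_swap y z s : kdom (y :: z :: s) (z :: y :: s).
Proof.
have pS i : pres (kswap_mx (size s) i).
  case: i => [|[|i]]; first exact: pres0.
    by apply: pres_block; try exact: pres0; apply: pres1.
  by apply: pres_block; apply: pres_block;
     first [exact: pres0 | exact: pres1 | apply: presN; exact: pres1].
have cS y' z' i : kdiff (y' :: z' :: s) i *m kswap_mx (size s) i =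
                  kswap_mx (size s) i.+1 *m kdiff (z' :: y' :: s) i.
  case: i => [|[|i]]; first by rewrite !kdiff0 !mulmx0.
  - rewrite !kdiff_block [LHS]mulmx_block [RHS]mulmx_block !kdiff0.
    have sE x : x%:M = block_mx x%:M 0 0 x%:M :> 'M[R]_(kr s 1 + kr s 0).
      exact: scalar_mx_block.
    rewrite !(mul0mx, mulmx0, mul1mx, mulmx1, oppr0, addr0, add0r).
    rewrite !sE !mulmx_block !(mul0mx, mulmx0, mul1mx, mulmx1, oppr0, addr0, add0r).
    rewrite !add_block_mx !(addr0, add0r).
    by congr (block_mx _ _ (block_mx _ _ _ _) _); apply: mx_thin (krank0 _).
  - rewrite !kdiff_block.
    have sE x : x%:M = block_mx x%:M 0 0 x%:M :> 'M[R]_(kr s i.+2 + kr s i.+1).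
      exact: scalar_mx_block.
    have sE' x : x%:M = block_mx x%:M 0 0 x%:M :> 'M[R]_(kr s i.+1 + kr s i).
      exact: scalar_mx_block.
    rewrite [LHS]mulmx_block [RHS]mulmx_block. rewrite !sE ?sE'. rewrite !mulmx_block ?add_block_mx ?opp_block_mx !(mul0mx, mulmx0, mul1mx, mulmx1, mulmxN, mulNmx, opprK, oppr0, addr0, add0r).
    rewrite !mulmx_block !add_block_mx.
    by rewrite !(mul0mx, mulmx0, mul1mx, mulmx1, mulmxN, mulNmx, opprK, oppr0, addr0, add0r).
exists (fun i => kswap_mx (size s) i), (fun i => kswap_mx (size s) i).
split=> i //; case: i => [|[|i]]; first exact: mx_thin.
  rewrite [LHS]mulmx_block !(mul0mx, mulmx0, mul1mx, addr0, add0r).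
  have -> : 1%:M = block_mx 1%:M 0 0 1%:M :> 'M[R]_(krank (size s).+1 1 + krank (size s).+1 0).
    exact: scalar_mx_block.
  by congr block_mx; apply: mx_thin.
rewrite [LHS]mulmx_block !mulmx_block !add_block_mx.
rewrite !(mul0mx, mulmx0, mul1mx, mulmxN, mulNmx, opprK, oppr0, addr0, add0r).
have sE m n : block_mx 1%:M 0 0 1%:M = 1%:M :> 'M[R]_(m + n).
  by rewrite -scalar_mx_block.
have zE m n p q : block_mx 0 0 0 0 = 0 :> 'M[R]_(m + n, p + q).
  by rewrite -[RHS]submxK; congr block_mx; apply/matrixP => a b; rewrite !mxE.
by rewrite !sE !zE -[RHS]sE.
Qed.

Lemma kdom_perm s t : perm_eq s t -> kdom s t.
Proof.
elim: s t => [|z s IHs] t.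
  by rewrite perm_sym => /perm_nilP ->; apply: kdom_refl.
move=> st; have /splitPr tE: z \in t by rewrite -(perm_mem st) mem_head.
case: tE st => t1 t2; rewrite -[z :: t2]cat1s perm_sym perm_catCA perm_cons perm_sym => st.
apply: kdom_trans (kdom_skip z (IHs _ st)) _.
elim: t1 {st} => [|y t1 IHt] /=; first exact: kdom_refl.
exact: kdom_trans (kdom_swap _ _ _) (kdom_skip _ IHt).
Qed.
End Reordering.
(** * Strands of Koszul homology *)

Section Vanishing.
Variable R : comNzRingType.
Implicit Types (s t : seq R) (z : R) (A B C X Y Z : nat -> R -> Prop).

Local Notation kr s i := (krank (size s) i).

(* A and B are graded submodules of R, given by their components A d and B d.
   The homology of the complex K(s; A/B) vanishes in homological degree i and
   internal degree i + e + 1. *)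
Definition kvanish_fun n f A B i e :=
  forall v : 'rV[R]_(krank n i.+1),
    inrow (A e.+1) v -> inrow (B e.+2) (v *m kdiff_fun n f i) ->
  exists w : 'rV_(krank n i.+2),
    inrow (A e) w /\ inrow (B e.+1) (v - w *m kdiff_fun n f i.+1).

Definition kvanish s := kvanish_fun (size s) (nth 0 s).

Definition gsub A := forall d, subgroup (A d).

Definition gmul z A B := forall d p, A d p -> B d.+1 (z * p).

Definition gincl A B := forall d p, A d p -> B d p.

Definition gmod s A := gsub A /\ forall z, z \in s -> gmul z A A.

Lemma inrow_kdiff s A d i (v : 'rV_(kr s i.+1)) :
  gmod s A -> inrow (A d) v -> inrow (A d.+1) (v *m kdiff s i).
Proof.
case=> sA; elim: s i v => [|z s IHs] [|i] v mA Av;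
  rewrite ?kdiff0 ?mulmx0; try exact: inrow0.
move: Av; rewrite -[v]hsubmxK kdiff_cons => /inrow_row_mx[Al Ar].
apply/inrow_row_mx; split; last first.
  by apply: inrowN => //; apply: IHs => // y y_s; apply: mA; rewrite inE y_s orbT.
apply: inrowD => //; last by apply: inrowZ Ar => p; apply: mA; rewrite mem_head.
by apply: IHs => // y y_s; apply: mA; rewrite inE y_s orbT.
Qed.

Lemma inrow_addZ (A B C : R -> Prop) z m (v : 'rV_m) :
  (forall p, C p -> exists a b, [/\ A a, B b & p = a + z * b]) -> inrow C v ->
  exists va vb : 'rV_m, [/\ inrow A va, inrow B vb & v = va + z *: vb].
Proof.
move=> CAB Cv.
have /fin_all_exists[f fP] j : exists ab : R * R,
    [/\ A ab.1, B ab.2 & v 0 j = ab.1 + z * ab.2].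
  by have [a [b [Aa Bb ->]]] := CAB _ (Cv j); exists (a, b).
exists (\row_j (f j).1), (\row_j (f j).2); split.
- by move=> j; rewrite mxE; case: (fP j).
- by move=> j; rewrite mxE; case: (fP j).
- by apply/rowP => j; rewrite !mxE; case: (fP j).
Qed.

Lemma kdiff_sq s i (w : 'rV_(kr s i.+2)) : w *m kdiff s i.+1 *m kdiff s i = 0.
Proof. by rewrite -mulmxA kdiffK mulmx0. Qed.

(** The exact sequence [0 -> Y/X -> Z/X -> Z/Y -> 0], read at its middle term. *)
Lemma kvanish_ext s X Y Z i e :
  gsub X -> gsub Y -> gsub Z -> gincl X Y -> gincl Y Z ->
  kvanish s Y X i e -> kvanish s Z Y i e -> kvanish s Z X i e.
Proof.
move=> sX sY sZ XY YZ vYX vZY v Zv Xv.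
have [w [Zw Yw]] := vZY v Zv (inrowS (@XY _) Xv).
have [|w' [Yw' Xw']] := vYX _ Yw.
  by rewrite mulmxBl [w *m _ *m _]kdiff_sq subr0.
exists (w + w'); split; first by apply: inrowD => //; apply: inrowS Yw'; apply: YZ.
by rewrite mulmxDl opprD addrA.
Qed.

(** The same exact sequence, read at [Y/X]. The connecting map keeps the internal degree, so
    homological degree [i.+1] for [Z/Y] comes with a strand one lower. *)
Lemma kvanish_sub s X Y Z i e :
  gmod s X -> gmod s Y -> gmod s Z -> gincl X Y -> gincl Y Z ->
  kvanish s Z X i e.+1 -> kvanish s Z Y i.+1 e -> kvanish s Y X i e.+1.
Proof.
move=> gX gY gZ XY YZ vZX vZY v Yv Xv.
have [w [Zw Xw]] := vZX v (inrowS (@YZ _) Yv) Xv.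
have [|w' [Zw' Yw']] := vZY w Zw.
  rewrite -[w *m _](subKr v); apply: inrowB (gY.1 _) Yv _.
  exact: inrowS (@XY _) Xw.
exists (w - w' *m kdiff s i.+2); split=> //.
by rewrite mulmxBl [w' *m _ *m _]kdiff_sq subr0.
Qed.

(** Here [B' = B + z Z], and [z] is not a zero divisor on [Z/B]. Up to a boundary and an element of
    [B], a cycle modulo [B] equals [z u] with [u] again a cycle modulo [B], and the homotopy for [z]
    makes [z u] a boundary. *)
Lemma kvanish_nzd_down s z Z B B' i e :
  z \in s -> gmod s Z -> gmod s B -> gincl B B' -> gmul z Z B' ->
  (forall d p, B' d.+1 p -> exists b u, [/\ B d.+1 b, Z d u & p = b + z * u]) ->
  (forall d u, Z d u -> B d.+1 (z * u) -> B d u) ->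
  kvanish s Z B' i e -> kvanish s Z B i e.
Proof.
move=> zs gZ gB BB' zZ B'E nzd van v Zv Bv.
have [h [hp hE]] := kdiff_homotopy zs.
have [w [Zw /(inrow_addZ (@B'E _))[b [u [Bb Zu vE]]]]] :=
  van v Zv (inrowS (@BB' _) Bv).
have BuD : inrow (B e.+1) (u *m kdiff s i).
  move=> j; apply: nzd; first exact: inrow_kdiff Zu j.
  have -> : z * (u *m kdiff s i) 0 j = (v *m kdiff s i - b *m kdiff s i) 0 j.
    rewrite -[v](subrK (w *m kdiff s i.+1)) vE mulmxDl kdiff_sq addr0 mulmxDl.
    by rewrite addrAC subrr add0r -scalemxAl !mxE.
  by apply: inrowB (gB.1 _) Bv _ j; apply: inrow_kdiff Bb.
exists (w + u *m h i.+1); split.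
  by apply: inrowD (gZ.1 _) Zw _; apply: hp Zu; apply: gZ.1.
have -> : v - (w + u *m h i.+1) *m kdiff s i.+1 = b + u *m kdiff s i *m h i.
  rewrite mulmxDl opprD addrA vE -addrA; congr (_ + _).
  rewrite -mul_mx_scalar -hE mulmxDr !mulmxA addrC addrA addNr add0r //.
by apply: inrowD (gB.1 _) Bb _; apply: hp BuD; apply: gB.1.
Qed.

(** The boundary of a cycle [v] modulo [B'] has the form [b + z u], where [u] is a cycle modulo [B]
    one homological degree lower. If [u'] bounds [u] modulo [B], then [v - z u'] is a cycle modulo
    [B], while [z u'] lies in [B']. *)
Lemma kvanish_nzd_up s z Z B B' e :
  gmod s Z -> gmod s B -> gsub B' -> gincl B B' -> gmul z Z Z -> gmul z B B ->
  gmul z Z B' ->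
  (forall d p, B' d.+1 p -> exists b u, [/\ B d.+1 b, Z d u & p = b + z * u]) ->
  (forall d u, Z d u -> B d.+1 (z * u) -> B d u) ->
  (forall i, kvanish s Z B i e) -> forall i, kvanish s Z B' i e.
Proof.
move=> gZ gB sB' BB' zZZ zB zZ B'E nzd van i v Zv.
move=> /(inrow_addZ (@B'E _))[b [u [Bb Zu vDE]]].
have [u' [Zu' Bu']] : exists u' : 'rV_(kr s i.+1),
    inrow (Z e) u' /\ inrow (B e.+2) ((v - z *: u') *m kdiff s i).
  case: i v Zv b u Bb Zu vDE => [|i] v Zv b u Bb Zu vDE.
    exists 0; split; first by apply: inrow0; apply: gZ.1.
    by rewrite kdiff0 mulmx0; apply: inrow0; apply: gB.1.
  have [|u' [Zu' Bu']] := van i u Zu.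
    move=> j; apply: nzd; first exact: inrow_kdiff Zu j.
    have -> : z * (u *m kdiff s i) 0 j = (- (b *m kdiff s i)) 0 j.
      have := kdiff_sq v; rewrite [v *m _]vDE mulmxDl => /eqP.
      by rewrite addrC addr_eq0 -scalemxAl => /eqP <-; rewrite !mxE.
    by apply: inrowN (gB.1 _) _ j; apply: inrow_kdiff Bb.
  exists u'; split=> //; rewrite mulmxBl [v *m _]vDE -addrA -scalemxAl -scalerBr.
  by apply: inrowD (gB.1 _) Bb _; apply: inrowZ Bu' => p; apply: zB.
have [|w [Zw Bw]] := van i (v - z *: u') _ Bu'.
  by apply: inrowB (gZ.1 _) Zv _; apply: inrowZ Zu' => p; apply: zZZ.
exists w; split=> //; rewrite -[v](subrK (z *: u')) addrAC.
apply: inrowD => //; first exact: inrowS (@BB' _) Bw.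
by apply: inrowZ Zu' => p; apply: zZ.
Qed.

(** Multiplication by [y] identifies [Z/C], where [C] is the colon [X : y], with [Y/X] one degree
    higher; the strand therefore goes up by 1. *)
Lemma kvanish_shift s y C X Y Z i e :
  gmod s X -> gmod s Z -> gmul y C X -> gmul y Z Y -> gincl X Y ->
  (forall d p, Y d.+1 p -> exists a g, [/\ X d.+1 a, Z d g & p = a + y * g]) ->
  (forall d g, Z d g -> X d.+1 (y * g) -> C d g) ->
  kvanish s Z C i e -> kvanish s Y X i e.+1.
Proof.
move=> gX gZ yC yZ XY YE colon van v Yv Xv.
have [a [g [Xa Zg vE]]] := inrow_addZ (@YE _) Yv.
have [|w [Zw Cw]] := van g Zg.
  move=> j; apply: colon; first exact: inrow_kdiff Zg j.
  have -> : y * (g *m kdiff s i) 0 j = (v *m kdiff s i - a *m kdiff s i) 0 j.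
    by rewrite vE mulmxDl addrAC subrr add0r -scalemxAl !mxE.
  by apply: inrowB (gX.1 _) Xv _ j; apply: inrow_kdiff Xa.
exists (y *: w); split; first by apply: inrowZ Zw => p; apply: yZ.
rewrite vE -scalemxAl -addrA -scalerBr; apply: inrowD (gX.1 _) Xa _.
by apply: inrowZ Cw => p; apply: yC.
Qed.

(** Since [z] annihilates [A/B], the homology for [z :: s] consists of two copies of that for [s].
    One of them is shifted by 1 in both the homological and the internal degree, which leaves the
    strand unchanged. *)
Lemma kvanish_cons s z A B e :
  gsub A -> gsub B -> gmul z A B ->
  (forall i, kvanish s A B i e) -> forall i, kvanish (z :: s) A B i e.
Proof.
move=> sA sB zAB van i v; rewrite -[v]hsubmxK.
move: (lsubmx v) (rsubmx v) => /= a b {v} /inrow_row_mx[Aa Ab].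
have zbB d m (w : 'rV_m) : inrow (A d) w -> inrow (B d.+1) (z *: w).
  by apply: inrowZ => p; apply: zAB.
have hu : inrow (B e.+2) (row_mx a b *m kdiff (z :: s) i) ->
    exists u : 'rV_(kr s i.+1), inrow (A e) u /\ inrow (B e.+1) (b - u *m kdiff s i).
  case: i a b Aa Ab => [|i] a b Aa Ab.
    exists 0; split; first exact: inrow0.
    by rewrite [b - _](rV_thin _ 0 (krank0 _)); apply: inrow0.
  rewrite kdiff_cons => /inrow_row_mx[_ BbD].
  by apply: van => //; rewrite -[_ *m _]opprK; apply: inrowN.
move=> Bv; have {hu}[u [Au Bu]] := hu Bv.
have [w [Aw Bw]] : exists w : 'rV_(kr s i.+2),
    inrow (A e) w /\ inrow (B e.+1) (a - w *m kdiff s i.+1).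
  apply: van => //; case: i a b Aa Ab u Au Bu Bv => [|i] a b Aa Ab u Au Bu Bv.
    by rewrite -/(kdiff _ _) kdiff0 mulmx0; apply: inrow0.
  move: Bv; rewrite kdiff_cons => /inrow_row_mx[Ba _].
  by rewrite -[_ *m _](addrK (z *: b)); apply: inrowB => //; apply: zbB.
exists (row_mx w (- u)); split.
  by apply/inrow_row_mx; split=> //; apply: inrowN.
rewrite -/(kdiff (z :: s) i.+1) kdiff_cons opp_row_mx [row_mx a b + _]add_row_mx.
apply/inrow_row_mx; split; last by rewrite mulNmx opprK.
rewrite opprD addrA scalerN opprK; apply: inrowD => //.
exact: zbB.
Qed.

Lemma kvanish_cat r s A B e :
  gsub A -> gsub B -> (forall z, z \in r -> gmul z A B) ->
  (forall i, kvanish s A B i e) -> forall i, kvanish (r ++ s) A B i e.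
Proof.
move=> sA sB; elim: r => //= z r IHr rAB van.
apply: kvanish_cons => //; first by apply: rAB; rewrite mem_head.
by apply: IHr => // y y_r; apply: rAB; rewrite inE y_r orbT.
Qed.

Lemma kvanish_perm s t A B i e :
  gsub A -> gsub B -> perm_eq s t -> kvanish s A B i e -> kvanish t A B i e.
Proof.
move=> sA sB /kdom_perm[P [Q [pPQ cP cQ PQ]]] van v Av Bv.
have [|w [Aw Bw]] := van (v *m Q i.+1) ((pPQ _).2 _ (sA _) _ Av).
  by rewrite -mulmxA -cQ mulmxA; apply: (pPQ _).2.
exists (w *m P i.+2); split; first exact: (pPQ _).1.
rewrite -mulmxA -cP -[v]mulmx1 -PQ !mulmxA -mulmxBl.
exact: (pPQ _).1.
Qed.
End Vanishing.

(** * Change of rings *)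

Section Transfer.
Variables (R S : comNzRingType) (phi : {rmorphism R -> S}).
Implicit Types (A B : nat -> R -> Prop) (C D : nat -> S -> Prop).

Lemma map_kdiff n f i : map_mx phi (kdiff_fun n f i) = kdiff_fun n (phi \o f) i.
Proof.
elim: n f i => [|n IHn] f [|i] /=; rewrite ?map_mx0 //.
by rewrite map_block_mx map_mxN !IHn map_scalar_mx map_mx0.
Qed.

Lemma inrow_map (A : R -> Prop) (C : S -> Prop) m (v : 'rV_m) :
  (forall p, A p -> C (phi p)) -> inrow A v -> inrow C (map_mx phi v).
Proof. by move=> hAC Av j; rewrite mxE; apply: hAC. Qed.

(** The map induced by [phi] on homology is zero, a condition weaker than the vanishing of either
    group: cycles over [R] only have to become boundaries over [S]. This form allows elements that
    [phi] sends to 0 to be discarded. *)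
Definition kvanish_map n f A B C D i e :=
  forall v : 'rV[R]_(krank n i.+1),
    inrow (A e.+1) v -> inrow (B e.+2) (v *m kdiff_fun n f i) ->
  exists w : 'rV[S]_(krank n i.+2), inrow (C e) w /\
    inrow (D e.+1) (map_mx phi v - w *m kdiff_fun n (phi \o f) i.+1).

Lemma kvanish_mapW n f A B C D i e :
  (forall d p, A d p -> C d (phi p)) -> (forall d p, B d p -> D d (phi p)) ->
  kvanish_fun n f A B i e -> kvanish_map n f A B C D i e.
Proof.
move=> hAC hBD van v Av Bv; have [w [Aw Bw]] := van v Av Bv.
exists (map_mx phi w); split; first exact: inrow_map (@hAC _) Aw.
rewrite -map_kdiff -map_mxM -map_mxB.
exact: inrow_map (@hBD _) Bw.
Qed.

(** A cycle for [s] is extended by 0 to [r ++ s]. As [phi] kills [r], the components of a bounding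
    chain that involve [r] contribute nothing to the part free of [r]. *)
Lemma kvanish_map_drop r s A B C D i e :
  gsub A -> gsub B -> (forall z, z \in r -> phi z = 0) ->
  kvanish_map (size (r ++ s)) (nth 0 (r ++ s)) A B C D i e ->
  kvanish_map (size s) (nth 0 s) A B C D i e.
Proof.
move=> sA sB; elim: r => //= z r IHr r0 van.
apply: IHr => [y y_r|]; first by apply: r0; rewrite inE y_r orbT.
move=> v Av Bv; have [||w] := van (row_mx v 0).
- by apply/inrow_row_mx; split=> //; apply: inrow0.
- move: (r ++ s) v {Av} Bv => t; case: i {van} => [|i] v Bv.
    by rewrite -/(kdiff (z :: t) 0) kdiff0 mulmx0; apply: inrow0.
  rewrite -/(kdiff (z :: t) i.+1) kdiff_cons mul0mx scaler0 addr0 oppr0.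
  by apply/inrow_row_mx; split=> //; apply: inrow0.
rewrite -[w]hsubmxK; move: (lsubmx w) (rsubmx w) => /= a b {w} [].
move=> /inrow_row_mx[Ca _]; rewrite mul_row_block map_row_mx.
rewrite opp_row_mx [row_mx _ _ + _]add_row_mx => /inrow_row_mx[Da _].
exists a; split=> //; move: Da.
by rewrite /= r0 ?mem_head // mul_mx_scalar scale0r addr0.
Qed.
End Transfer.

Lemma eq_kvanish (R : comNzRingType) n (f g : nat -> R) A B i e :
  f =1 g -> kvanish_fun n f A B i e -> kvanish_fun n g A B i e.
Proof. by move=> fg; rewrite /kvanish_fun !(eq_kdiff n _ fg). Qed.

Lemma eq_kvanish_map (R S : comNzRingType) (phi : {rmorphism R -> S}) n
    (f g : nat -> R) A B C D i e :
  f =1 g -> kvanish_map phi n f A B C D i e -> kvanish_map phi n g A B C D i e.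
Proof.
move=> fg; have fg' : phi \o f =1 phi \o g by move=> j /=; rewrite fg.
by rewrite /kvanish_map !(eq_kdiff n _ fg) !(eq_kdiff n _ fg').
Qed.

Lemma nth0_map (R S : comNzRingType) (phi : {rmorphism R -> S}) s :
  nth 0 (map phi s) =1 phi \o nth 0 s.
Proof.
move=> j /=; have [lt_j | le_j] := ltnP j (size s); first exact: nth_map.
by rewrite !nth_default ?size_map ?rmorph0.
Qed.

Lemma kvanish_mapE (R S : comNzRingType) (phi : {rmorphism R -> S}) s A B i e :
  kvanish (map phi s) A B i e <-> kvanish_fun (size s) (phi \o nth 0 s) A B i e.
Proof.
have nthE := nth0_map phi s.
rewrite /kvanish size_map; split; first exact: eq_kvanish.
by apply: eq_kvanish => j; rewrite nthE.
Qed.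

Section RetractLift.
Variables (R S : comNzRingType) (iota : {rmorphism S -> R}).
Implicit Types (A B : nat -> R -> Prop) (C D : nat -> S -> Prop).

(** A cycle is carried to [R] by [iota], bounded there, and carried back by [rho]. *)
Lemma kvanish_retract (rho : {rmorphism R -> S}) r s A B C D i e :
  gsub A -> gsub B -> cancel iota rho -> (forall z, z \in r -> rho z = 0) ->
  (forall d p, A d p -> C d (rho p)) -> (forall d p, B d p -> D d (rho p)) ->
  (forall d p, C d p -> A d (iota p)) -> (forall d p, D d p -> B d (iota p)) ->
  kvanish (r ++ map iota s) A B i e -> kvanish s C D i e.
Proof.
move=> sA sB iotaK r0 hAC hBD hCA hDB /(kvanish_mapW hAC hBD).
move=> /(kvanish_map_drop sA sB r0); rewrite size_map.
move=> /(eq_kvanish_map (nth0_map iota s)) van v Cv Dv.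
have [||w [Cw Dw]] := van (map_mx iota v).
- exact: inrow_map (@hCA _) Cv.
- by rewrite -map_kdiff -map_mxM; apply: inrow_map (@hDB _) Dv.
exists w; split=> //; move: Dw.
rewrite (@eq_kdiff _ _ _ (nth 0 s)) => [|j /=]; last exact: iotaK.
by rewrite -map_mx_comp (map_mx_id iotaK).
Qed.

(** The hypotheses say that [iota] induces an isomorphism from [C/D] to [A/B], so both sides compute
    the homology of one complex. *)
Lemma kvanish_lift s A B C D i e :
  gsub B -> (forall d p, C d p -> A d (iota p)) ->
  (forall d p, D d p -> B d (iota p)) ->
  (forall d p, A d p -> exists c b, [/\ C d c, B d b & p = iota c + b]) ->
  (forall d p, C d p -> B d (iota p) -> D d p) ->
  gmod s C -> gmod (map iota s) B ->
  kvanish s C D i e -> kvanish (map iota s) A B i e.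
Proof.
move=> sB hCA hDB AE BD gC gB van; apply/kvanish_mapE => v Av Bv.
have [c [b [Cc Bb vE]]] : exists (c : 'rV[S]_(krank (size s) i.+1)) (b : 'rV[R]_(krank (size s) i.+1)),
    [/\ inrow (C e.+1) c, inrow (B e.+1) b & v = map_mx iota c + b].
  have /fin_all_exists[f fP] j : exists cb : S * R,
      [/\ C e.+1 cb.1, B e.+1 cb.2 & v 0 j = iota cb.1 + cb.2].
    by have [c [b [Cc Bb vE]]] := AE _ _ (Av j); exists (c, b).
  exists (\row_j (f j).1), (\row_j (f j).2); split=> [j|j|]; rewrite ?mxE.
  - by case: (fP j).
  - by case: (fP j).
  - by apply/rowP => j; rewrite !mxE; case: (fP j).
have gB' d m (u : 'rV_(krank (size s) m.+1)) : inrow (B d) u ->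
    inrow (B d.+1) (u *m kdiff_fun (size s) (iota \o nth 0 s) m).
  move: u; rewrite -(eq_kdiff _ _ (nth0_map iota s)) -(size_map iota s).
  by move=> u; apply: (@inrow_kdiff _ (map iota s)).
have [|w [Cw Dw]] := van c Cc.
  move=> j; apply: BD; first exact: inrow_kdiff Cc j.
  have -> : iota ((c *m kdiff s i) 0 j) =
      (v *m kdiff_fun (size s) (iota \o nth 0 s) i
       - b *m kdiff_fun (size s) (iota \o nth 0 s) i) 0 j.
    by rewrite vE -mulmxBl addrK -map_kdiff -map_mxM [RHS]mxE.
  by apply: inrowB (sB _) Bv _ j; apply: gB'.
exists (map_mx iota w); split; first exact: inrow_map (@hCA _) Cw.
rewrite -map_kdiff -map_mxM vE addrAC -map_mxB.
by apply: inrowD => //; apply: inrow_map (@hDB _) Dw.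
Qed.
End RetractLift.

(** * Ideals given by generators *)

Section Ideals.
Variable R : comNzRingType.
Implicit Types (g : R -> Prop).

Inductive ideal g : R -> Prop :=
| ideal0 : ideal g 0
| idealS c x p : g x -> ideal g p -> ideal g (c * x + p).

Lemma idealD g p q : ideal g p -> ideal g q -> ideal g (p + q).
Proof.
elim=> [|c x {}p gx _ IH] Iq; first by rewrite add0r.
by rewrite -addrA; apply: idealS => //; apply: IH.
Qed.

Lemma idealM g c p : ideal g p -> ideal g (c * p).
Proof.
elim=> [|d x {}p gx _ IH]; first by rewrite mulr0; apply: ideal0.
by rewrite mulrDr mulrA; apply: idealS.
Qed.

Lemma idealG g x : g x -> ideal g x.
Proof. by move=> gx; rewrite -[x]addr0 -[x]mul1r; apply: idealS => //; apply: ideal0. Qed.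

Lemma ideal_subgroup g : subgroup (ideal g).
Proof.
split=> [|p q Ip Iq]; first exact: ideal0.
by apply: idealD => //; rewrite -mulN1r; apply: idealM.
Qed.

Lemma idealN g p : ideal g p -> ideal g (- p).
Proof. by apply: subgroupN; apply: ideal_subgroup. Qed.

Lemma idealB g p q : ideal g p -> ideal g q -> ideal g (p - q).
Proof. exact: (ideal_subgroup g).2. Qed.

Lemma ideal_sum g (I : Type) (r : seq I) (P : pred I) (F : I -> R) :
  (forall i, P i -> ideal g (F i)) -> ideal g (\sum_(i <- r | P i) F i).
Proof. by apply: subgroup_sum; apply: ideal_subgroup. Qed.

Lemma ideal_le g g' p : (forall x, g x -> ideal g' x) -> ideal g p -> ideal g' p.
Proof.
move=> gg'; elim=> [|c x {}p gx _ IH]; first exact: ideal0.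
by apply: idealD => //; apply: idealM; apply: gg'.
Qed.
End Ideals.

Lemma ideal_map (R S : comNzRingType) (phi : {rmorphism R -> S}) g g' p :
  (forall x, g x -> ideal g' (phi x)) -> ideal g p -> ideal g' (phi p).
Proof.
move=> gg'; elim=> [|c x {}p gx _ IH]; first by rewrite rmorph0; apply: ideal0.
by rewrite rmorphD rmorphM; apply: idealD => //; apply: idealM; apply: gg'.
Qed.

(** * Exactness of the Koszul complex of a regular sequence *)

Section Exactness.
Variable R : comNzRingType.
Implicit Types (s : seq R).

Local Notation kr s i := (krank (size s) i).
Local Notation ideal_seq s := (ideal (fun x => x \in s)).

Lemma inrow_kdiff_ideal s i (w : 'rV_(kr s i.+1)) :
  inrow (ideal_seq s) (w *m kdiff s i).
Proof.
have sI := @ideal_subgroup R.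
elim: s i w => [|z s IHs] [|i] w; rewrite ?kdiff0 ?mulmx0; try exact: inrow0.
have sub p : ideal_seq s p -> ideal_seq (z :: s) p.
  by apply: ideal_le => x x_s; apply: idealG; rewrite inE x_s orbT.
rewrite -[w]hsubmxK kdiff_cons; apply/inrow_row_mx; split.
  apply: inrowD => //; first exact: inrowS (IHs _ _).
  move=> j; rewrite mxE mulrC; apply: idealM.
  by apply: idealG; rewrite mem_head.
by apply: inrowN => //; apply: inrowS (IHs _ _).
Qed.

Lemma kdiff_im1 s (b : 'rV_(kr s 1)) :
  inrow (ideal_seq s) b -> exists w, b = w *m kdiff s 1.
Proof.
move=> Ib; rewrite [b]row_sum_delta.
have im_delta p : ideal_seq s p -> forall d : 'rV_(kr s 1),
    exists w, p *: d = w *m kdiff s 1.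
  elim=> [|c x {}p x_s _ IH] d; first by exists 0; rewrite scale0r mul0mx.
  have [h [_ /(_ 0%N)]] := kdiff_homotopy x_s.
  rewrite kdiff0 mul0mx addr0 => hE; have [w wE] := IH d.
  exists (c *: d *m h 1%N + w); rewrite mulmxDl -wE -mulmxA hE mul_mx_scalar.
  by rewrite scalerDl scalerA mulrC.
have /fin_all_exists[f fE] j := im_delta _ (Ib j) (delta_mx 0 j).
exists (\sum_j f j); rewrite mulmx_suml; apply: eq_bigr => j _; exact: fE.
Qed.

(** The sequence is read from its end, to match the recursion of [kdiff]. *)
Fixpoint regular_seq s :=
  if s is z :: s' then
    (forall p, ideal_seq s' (z * p) -> ideal_seq s' p) /\ regular_seq s'
  else True.

(** In a cycle [(a, b)] the part [b] is a cycle for [s]. It is a boundary [d u], by induction or, in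
    degree 0, because [z b] lies in the ideal of [s] and [z] is not a zero divisor modulo it. Then
    [a + z u] is a cycle for [s]. *)
Lemma kdiff_exact s i (v : 'rV_(kr s i.+2)) :
  regular_seq s -> v *m kdiff s i.+1 = 0 -> exists w, v = w *m kdiff s i.+2.
Proof.
elim: s i v => [|z s IHs] i v; first by exists 0; apply: rV_thin.
case=> reg_z reg_s; rewrite -[v]hsubmxK kdiff_cons.
move: (lsubmx v) (rsubmx v) => /= a b {v}.
rewrite -[RHS]row_mx0 => /eq_row_mx[aD /eqP]; rewrite oppr_eq0 => /eqP bD.
have [u bE] : exists u, b = u *m kdiff s i.+1.
  case: i a b aD bD => [|i] a b aD bD; last exact: IHs.
  apply: kdiff_im1 => j; apply: reg_z.
  have -> : z * b 0 j = (- a *m kdiff s 1) 0 j.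
    by move/eqP: aD; rewrite addrC addr_eq0 mulNmx => /eqP <-; rewrite mxE.
  exact: inrow_kdiff_ideal.
have [//||w wE] := IHs i (a + z *: u); first by rewrite mulmxDl -scalemxAl -bE.
exists (row_mx w (- u)); rewrite kdiff_cons mulNmx opprK -bE; congr row_mx.
by rewrite -wE scalerN addrK.
Qed.
End Exactness.
(** * Polynomials *)

Section Substitution.
Variables (k : fieldType) (n m : nat).
Local Notation S := {mpoly k[n]}.
Local Notation T := {mpoly k[m]}.

Definition msub (h : 'I_n -> T) : {rmorphism S -> T} :=
  comp_mpoly [tuple h i | i < n].

Lemma msubX h i : msub h 'X_i = h i.
Proof. by rewrite /msub /= comp_mpolyXU -tnth_nth tnth_mktuple. Qed.

Lemma msubC h c : msub h c%:MP = c%:MP.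
Proof. exact: comp_mpolyC. Qed.

Lemma mpoly_rmorph_eq (f g : {rmorphism S -> T}) :
  (forall c, f c%:MP = g c%:MP) -> (forall i, f 'X_i = g 'X_i) -> f =1 g.
Proof.
move=> fgC fgX p; rewrite [p]mpolyE !rmorph_sum; apply: eq_bigr => /= a _.
rewrite -mul_mpolyC mpolyXE_id !rmorphM !rmorph_prod fgC; congr (_ * _).
by apply: eq_bigr => i _; rewrite !rmorphXn fgX.
Qed.

Lemma homog_mon (f : {rmorphism S -> T}) a :
  (forall i, f 'X_i \is 1.-homog) -> f 'X_[a] \is (mdeg a).-homog.
Proof.
move=> fX; rewrite mpolyXE_id rmorph_prod mdegE.
elim/big_rec2: _ => [|i p d _ IH]; first exact: dhomog1.
by apply: dhomogM => //; rewrite rmorphXn; have := dhomogMn (a i) (fX i); rewrite mul1n.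
Qed.

Lemma msub_homog h d p :
  (forall i, h i \is 1.-homog) -> p \is d.-homog -> msub h p \is d.-homog.
Proof.
move=> hX /dhomogP hp; rewrite [p]mpolyE rmorph_sum big_seq; apply: rpred_sum.
move=> a /hp <-; rewrite -mul_mpolyC rmorphM msubC mul_mpolyC; apply: dhomogZ.
by apply: homog_mon => i; rewrite msubX.
Qed.
End Substitution.

(** The polynomials with this property contain the constants and the variables and are closed under
    sums and products. The lemma serves to compute kernels of substitutions. *)
Lemma msub_ideal (k : fieldType) n (h : 'I_n -> {mpoly k[n]}) p :
  ideal (fun x => exists i, x = 'X_i - h i) (p - msub h p).
Proof.
set I := ideal _.
pose Q p := I (p - msub h p).
have QM a b : Q a -> Q b -> Q (a * b).
  rewrite /Q rmorphM => Qa Qb.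
  have -> : a * b - msub h a * msub h b =
      b * (a - msub h a) + msub h a * (b - msub h b).
    by rewrite mulrBr [msub h a * (_ - _)]mulrBr [b * a]mulrC [b * msub h a]mulrC addrA subrK.
  exact: idealD (idealM _ Qa) (idealM _ Qb).
have QD a b : Q a -> Q b -> Q (a + b).
  by rewrite /Q rmorphD opprD addrACA; apply: idealD.
have QC c : Q c%:MP by rewrite /Q msubC subrr; apply: ideal0.
suff QXm a : Q 'X_[a].
  elim/mpolyind: p => [|c a p _ _ IH]; first by rewrite -/(Q _) -mpolyC0; apply: QC.
  rewrite -mul_mpolyC; exact: QD (QM _ _ (QC c) (QXm a)) IH.
rewrite mpolyXE_id; elim/big_ind: _ => [||i _]; [by rewrite -mpolyC1 | exact: QM |].
elim: (a i) => [|d IHd]; first by rewrite expr0 -mpolyC1.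
rewrite exprS; refine (QM _ _ _ IHd); apply: idealG; exists i; by rewrite msubX.
Qed.

Section Homogeneous.
Variables (k : fieldType) (n : nat).
Local Notation S := {mpoly k[n]}.
Implicit Types (p q : S) (J : S -> Prop).

Local Notation pih d p := (pihomog mdeg d p).

Lemma homogX (i : 'I_n) : ('X_i : S) \is 1.-homog.
Proof. by rewrite dhomogX; apply/eqP; apply: mdeg1. Qed.

Lemma mvar_neq0 (i : 'I_n) : ('X_i : S) != 0.
Proof.
apply/eqP => /(congr1 (mcoeff U_(i)))/eqP.
by rewrite mcoeffX eqxx mcoeff0 oner_eq0.
Qed.

Lemma pihomogMh d e (x p : S) : x \is e.-homog ->
  pih d (p * x) = if (e <= d)%N then pih (d - e)%N p * x else 0.
Proof.
move=> hx; elim/mpolyind: p => [|c a p _ _ IH].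
  by rewrite !(mul0r, pihomog0); case: ifP.
rewrite mulrDl !pihomogD IH -scalerAl !linearZ /= pihomogX.
have hax : 'X_[a] * x \is (mdeg a + e).-homog by apply: dhomogM; rewrite ?dhomogX.
have [le_ed | lt_de] := leqP e d; last first.
  rewrite addr0 (pihomog_ne0 _ hax) ?scaler0 //.
  by apply: contraTneq lt_de => <-; rewrite -leqNgt leq_addl.
rewrite mulrDl -scalerAl; congr (c *: _ + _).
case: eqP => [aE | aN]; last first.
  rewrite mul0r (pihomog_ne0 _ hax) //; apply: contra_notN aN => /eqP <-.
  by rewrite addnK.
by rewrite pihomog_dE // -(subnK le_ed) -aE.
Qed.

Lemma ideal_pihomog g d p : (forall x, g x -> exists e, x \is e.-homog) ->
  ideal g p -> ideal g (pih d p).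
Proof.
move=> gh; elim=> [|c x {}p gx _ IH]; first by rewrite pihomog0; apply: ideal0.
rewrite pihomogD; apply: idealD => //; have [e xe] := gh _ gx.
rewrite (pihomogMh _ _ xe); case: ifP => _; last exact: ideal0.
by apply: idealM; apply: idealG.
Qed.

Definition hfam : nat -> S -> Prop := fun d p => p \is d.-homog.
Definition ifam J : nat -> S -> Prop := fun d p => p \is d.-homog /\ J p.
Definition vars : seq S := [seq 'X_i | i <- enum 'I_n].
(** This is the vanishing of [Tor_i(S/J, k)] in internal degree [i + e + 1], so that regularity at
    most [r] means [qvanish J i e] for all [i] and all [e >= r]. *)
Definition qvanish J i e := kvanish vars hfam (ifam J) i e.

Lemma gmod_hfam : gmod vars hfam.
Proof.
split=> [d | z /mapP[i _ ->] d p hp].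
  by split=> [|p q hp hq]; [apply: dhomog0 | apply: rpredB].
by rewrite /hfam -add1n; apply: dhomogM => //; apply: homogX.
Qed.

Lemma gmod_ifam g : gmod vars (ifam (ideal g)).
Proof.
split=> [d | z zv d p [hp Ip]]; last first.
  by split; [apply: gmod_hfam.2 | apply: idealM].
split=> [|p q [hp Ip] [hq Iq]].
  by split; [apply: dhomog0 | apply: ideal0].
by split; [apply: rpredB | apply: idealB].
Qed.

Lemma mem_vars i : ('X_i : S) \in vars.
Proof. by apply/mapP; exists i; rewrite ?mem_enum. Qed.
End Homogeneous.
Section VariableIdeals.
Variables (k : fieldType) (n : nat).
Local Notation S := {mpoly k[n]}.

Definition ivars (P : pred 'I_n) (x : S) : Prop := exists2 i, P i & x = 'X_i.

Definition kill (P : pred 'I_n) (i : 'I_n) : S := if P i then 0 else 'X_i.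

(** An ideal generated by variables is the kernel of a substitution with values in a domain. This
    decides membership and shows that the ideal is prime. *)
Lemma ideal_ivars P (p : S) : ideal (ivars P) p <-> msub (kill P) p = 0.
Proof.
split=> [|p0].
  elim=> [|c x {}p [i Pi ->] _ IH]; first by rewrite rmorph0.
  by rewrite rmorphD rmorphM msubX IH /kill Pi mulr0 addr0.
have := msub_ideal (kill P) p; rewrite p0 subr0.
apply: ideal_le => _ [i ->]; rewrite /kill; case: ifP => Pi.
  by rewrite subr0; apply: idealG; exists i.
by rewrite subrr; apply: ideal0.
Qed.

Lemma msub_kill_all (p : S) : msub (kill predT) p = (p@_0%MM)%:MP.
Proof.
elim/mpolyind: p => [|c a p _ _ IH]; first by rewrite rmorph0 mcoeff0.
rewrite rmorphD IH mcoeffD mpolyCD; congr (_ + _).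
rewrite -mul_mpolyC rmorphM msubC mcoeffCM mpolyCM mcoeffX; congr (_ * _).
rewrite mpolyXE_id rmorph_prod; case: eqVneq => [-> | a0].
  by rewrite big1 // => i _; rewrite mnm0E expr0 rmorph1.
have [i ai] : exists i, a i != 0%N.
  apply/existsP; apply: contra_neqT a0 => /existsPn a0.
  by apply/mnmP => i; rewrite mnm0E; apply/eqP; have := a0 i; rewrite negbK.
by rewrite (bigD1 i) //= rmorphXn msubX /kill /= expr0n (negPf ai) mul0r.
Qed.

Lemma regular_vars l : uniq l -> regular_seq [seq 'X_i : S | i <- l].
Proof.
elim: l => //= i l IHl /andP[i_l uniq_l]; split=> [p|]; last exact: IHl.
have eqI q : ideal (fun x : S => x \in [seq 'X_j | j <- l]) q <->
             ideal (ivars (mem l)) q.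
  split; apply: ideal_le => x.
    by case/mapP => j l_j ->; apply: idealG; exists j.
  by case=> j l_j ->; apply: idealG; apply/mapP; exists j.
move=> /eqI/ideal_ivars; rewrite rmorphM msubX /kill /= (negPf i_l).
move/eqP; rewrite mulf_eq0 (negPf (mvar_neq0 k i)) => /eqP p0.
by apply/eqI/ideal_ivars.
Qed.
End VariableIdeals.

(** * The Koszul resolution of the residue field *)

Section KoszulResolution.
Variables (k : fieldType) (n : nat).
Local Notation S := {mpoly k[n]}.
Local Notation X := (vars k n).
Local Notation kr i := (krank (size X) i).

Lemma vars_regular : regular_seq X.
Proof. by apply: regular_vars; rewrite enum_uniq. Qed.

Lemma ideal_vars (p : S) : ideal (fun x => x \in X) p <-> p@_0%MM = 0.
Proof.
have eqI : ideal (fun x => x \in X) p <-> ideal (ivars predT) p.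
  split; apply: ideal_le => x; first by case/mapP => i _ ->; apply: idealG; exists i.
  by case=> i _ ->; apply: idealG; apply: mem_vars.
split=> [/eqI/ideal_ivars/eqP | p0].
  by rewrite msub_kill_all mpolyC_eq0 => /eqP.
by apply/eqI/ideal_ivars; rewrite msub_kill_all p0 mpolyC0.
Qed.

Definition koszul : free_seq k n :=
  @FreeSeq k n (fun i => kr i.+1) (fun i _ => i) (fun i => kdiff X i.+1).

Lemma big_krank1 (V : nmodType) (F : 'I_(kr 1) -> V) (a : 'I_(kr 1)) :
  \sum_b F b = F a.
Proof.
have := krank1 (size X); move: (kr 1) F a => m F a m1; move: F a; rewrite m1.
by move=> F a; rewrite big_ord1 [a]ord1.
Qed.

Lemma krank1_inh : 'I_(kr 1).
Proof. by rewrite krank1; apply: ord0. Qed.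

Lemma koszul_resolves_k : resolves_k koszul.
Proof.
have gh := gmod_hfam k n.
pose a0 := krank1_inh.
have augE (v : 'rV[S]_(kr 1)) (a : 'I_(kr 1)) :
    @augmentation _ _ (kr 1) (fun _ => 1) v = (v 0 a)@_0%MM.
  by rewrite /augmentation (big_krank1 _ a) mul1r.
split=> [i a b | | i v] /=.
- rewrite leqnSn subSnn rowE.
  refine (@inrow_kdiff _ X (@hfam k n) 0 _ _ gh _ b) => j.
  by rewrite mxE /hfam; case: (_ && _); [apply: dhomog1 | apply: dhomog0].
- exists (fun _ => 1); split=> // [c | v].
    by exists (const_mx c%:MP); rewrite (augE _ a0) mxE mcoeffC eqxx mulr1.
  split=> [v0 | [w ->]].
    by apply: kdiff_im1 => j; apply/ideal_vars; rewrite -augE.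
  by rewrite (augE _ a0); apply/ideal_vars; apply: inrow_kdiff_ideal.
- split; first by apply: kdiff_exact; apply: vars_regular.
  by case=> w ->; rewrite kdiff_sq.
Qed.

Lemma map_pihomog_kdiff s d i (w : 'rV[S]_(krank (size s) i.+1)) :
  (forall z, z \in s -> z \is 1.-homog) ->
  map_mx (pihomog mdeg d.+1) (w *m kdiff s i) =
  map_mx (pihomog mdeg d) w *m kdiff s i.
Proof.
have m0 a b e : map_mx (pihomog mdeg e) (0 : 'M[S]_(a, b)) = 0.
  by apply/matrixP=> x y; rewrite !mxE pihomog0.
elim: s i w => [|z s IHs] [|i] w s1; rewrite ?kdiff0 ?mulmx0 ?m0 //.
have s1' y : y \in s -> y \is 1.-homog by move=> ys; apply: s1; rewrite inE ys orbT.
rewrite -[w]hsubmxK; move: (lsubmx w) (rsubmx w) => /= a b {w}.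
rewrite map_row_mx !kdiff_cons map_row_mx -!IHs //; congr row_mx.
  apply/rowP=> j; rewrite !mxE pihomogD; congr (_ + _).
  rewrite mulrC (pihomogMh _ _ (s1 _ (mem_head _ _))) /= subn1 /= mulrC.
  by [].
by apply/rowP=> j; rewrite !mxE pihomogN.
Qed.

Lemma vars_homog z : z \in X -> z \is 1.-homog.
Proof. by case/mapP => i _ ->; apply: homogX. Qed.

Lemma kvanish_vars i e : kvanish X (@hfam k n) (ifam (ideal (fun _ => False))) i e.
Proof.
have I0 (p : S) : ideal (fun _ => False) p -> p = 0 by elim.
move=> v hv Bv.
have [w vE] : exists w, v = w *m kdiff X i.+1.
  case: i v hv Bv => [|i] v hv Bv.
    (* In homological degree 0 the entries have degree [e.+1 > 0], hence no constant term. *)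
    apply: kdiff_im1 => j; apply/ideal_vars.
    apply: (dhomog_nemf_coeff (hv j)).
    by change (mdeg (0%MM : 'X_{1..n}) != e.+1); rewrite mdeg0.
  apply: kdiff_exact; first exact: vars_regular.
  by apply/rowP => j; rewrite [RHS]mxE; apply: I0; case: (Bv j).
(* Exactness gives a chain that need not be homogeneous; its component of degree [e] has the same
   boundary because the entries of the differential are linear. *)
exists (map_mx (pihomog mdeg e) w); split.
  by move=> j; rewrite mxE; apply: pihomogP.
rewrite -map_pihomog_kdiff; last exact: vars_homog.
rewrite -vE => j; rewrite !mxE pihomog_dE ?subrr; last exact: hv.
by split; [exact: dhomog0 | exact: ideal0].
Qed.
End KoszulResolution.
(** * Betti numbers and regularity *)

Lemma bounded_max (P : nat -> Prop) M : P 0%N -> (forall m, P m -> (m <= M)%N) ->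
  exists m, P m /\ ~ P m.+1.
Proof.
move=> P0 PM; apply: NNPP => noP; have : P M.+1.
  elim: M.+1 => // m Pm; apply: NNPP => nP.
  by apply: noP; exists m.
by move/PM; rewrite ltnn.
Qed.

Section QuotientDimension.
Variables (k : fieldType) (n r M : nat).
Local Notation V := 'rV[{mpoly k[n]}]_r.
Variables (Z B : V -> Prop) (coord : V -> 'rV[k]_M).
Hypotheses (Z0 : Z 0) (ZD : forall u v, Z u -> Z v -> Z (u + v))
  (ZZ : forall c u, Z u -> Z (c%:MP *: u))
  (B0 : B 0) (BZ : forall c u, B u -> B (c%:MP *: u))
  (coord_sum : forall m (c : 'I_m -> k) (z : 'I_m -> V),
    coord (\sum_l (c l)%:MP *: z l) = \sum_l c l *: coord (z l))
  (coord_inj : forall v, Z v -> coord v = 0 -> v = 0).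

Definition free_mod m (z : 'I_m -> V) :=
  forall c : 'I_m -> k, B (\sum_l (c l)%:MP *: z l) -> forall l, c l = 0.

Lemma free_mod_le m (z : 'I_m -> V) :
  (forall l, Z (z l)) -> free_mod z -> (m <= M)%N.
Proof.
move=> Zz free_z; rewrite leqNgt; apply/negP => lt_Mm.
pose A := \matrix_(l < m) coord (z l).
have kerA : kermx A != 0.
  rewrite -mxrank_eq0 mxrank_ker -lt0n subn_gt0.
  exact: leq_ltn_trans (rank_leq_col A) lt_Mm.
have [u uA /negP[]] : exists2 u : 'rV_m, u *m A = 0 & u != 0.
  have /rowV0Pn[u u_ker u0] := kerA.
  by exists u => //; apply/sub_kermxP.
apply/eqP/rowP => l; rewrite mxE; apply: (free_z (fun l => u 0 l)).
have ZS : Z (\sum_l (u 0 l)%:MP *: z l) by apply: big_ind => // i _; apply: ZZ.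
rewrite [X in B X](coord_inj ZS) // coord_sum -[RHS]uA mulmx_sum_row.
by apply: eq_bigr => i _; rewrite rowK.
Qed.

(** A family of maximal length among those independent modulo [B] is a basis of the quotient; the
    lengths are bounded because [coord] embeds [Z] into a space of dimension [M]. *)
Lemma quotient_dim_exists : exists m, quotient_dim Z B m.
Proof.
pose P m := exists z : 'I_m -> V, (forall l, Z (z l)) /\ free_mod z.
have P0 : P 0%N by exists (fun _ => 0); split=> [|c _] [].
have PM m : P m -> (m <= M)%N by case=> z [Zz]; apply: free_mod_le.
have [m [[z [Zz free_z]] nP]] := bounded_max P0 PM.
exists m, z; split=> // v Zv; apply: NNPP => no_c; apply: nP.
exists (fun l => oapp z v (unlift ord0 l)); split.
  by move=> l; case: unliftP => [j|] _ /=; [exact: Zz | exact: Zv].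
move=> c; rewrite big_ord_recl unlift_none /=.
under eq_bigr do rewrite liftK /=.
move=> Bc; have c0 : c ord0 = 0.
  apply/eqP/negPn/negP => c0; apply: no_c.
  exists (fun l => - (c ord0)^-1 * c (lift ord0 l)).
  have := BZ (c ord0)^-1 Bc; congr B.
  rewrite scalerDr scalerA -mpolyCM mulVf // mpolyC1 scale1r; congr (_ + _).
  rewrite scaler_sumr -sumrN; apply: eq_bigr => l _.
  by rewrite scalerA -mpolyCM mulNr mpolyCN scaleNr opprK.
move: Bc; rewrite c0 mpolyC0 scale0r add0r => /free_z cl l.
by case: (unliftP ord0 l) => [j ->|->].
Qed.
End QuotientDimension.

Lemma quotient_dim_neq0 (k : fieldType) n r (Z B : 'rV[{mpoly k[n]}]_r -> Prop)
    m v : quotient_dim Z B m -> Z v -> ~ B v -> m != 0%N.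
Proof.
case=> z [_ _ span] Zv nBv; apply/negP => /eqP m0; apply: nBv.
have [c] := span v Zv; case: m z span c m0 => // z _ c _.
by rewrite big_ord0 subr0.
Qed.

Lemma quotient_dim_0 (k : fieldType) n r (Z B : 'rV[{mpoly k[n]}]_r -> Prop) m :
  quotient_dim Z B m -> (forall v, Z v -> B v) -> m = 0%N.
Proof.
case: m => // m [z [Zz free_z _]] ZB.
suff Bz : B (\sum_l ((l == ord0)%:R)%:MP *: z l).
  by have /eqP := free_z _ Bz ord0; rewrite eqxx oner_eq0.
rewrite (bigD1 ord0) //= mpolyC1 scale1r [X in _ + X]big1 => [|i /negPf ->].
  by rewrite addr0; apply: ZB.
by rewrite mpolyC0 scale0r.
Qed.

Section Betti.
Variables (k : fieldType) (n : nat).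
Local Notation S := {mpoly k[n]}.
Local Notation X := (vars k n).
Local Notation kr i := (krank (size X) i).
Variable g : S -> Prop.
Local Notation J := (ideal g).

Lemma betti_exists (F : free_seq k n) i j : exists m, betti J F i j m.
Proof.
(* Rows of degree [j] involve only monomials of degree at most [j], so finitely many coefficients
   determine them. *)
pose I : finType := ('I_(frank F i) * 'X_{1..n < j.+1})%type.
have Z0 (l : nat) : in_degree (@shift k n F l) j (0 : 'rV[S]_(frank F l)).
  by move=> a; rewrite mxE; case: ifP => // _; apply: dhomog0.
have ZD (l : nat) (u v : 'rV[S]_(frank F l)) : in_degree (@shift k n F l) j u -> in_degree (@shift k n F l) j v ->
    in_degree (@shift k n F l) j (u + v).
  move=> hu hv a; have := hu a; have := hv a; rewrite mxE; case: ifP => _.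
    by move=> ? ?; apply: rpredD.
  by move=> /eqP -> /eqP ->; rewrite addr0.
have ZZ (l : nat) c (u : 'rV[S]_(frank F l)) : in_degree (@shift k n F l) j u ->
    in_degree (@shift k n F l) j (c%:MP *: u).
  move=> hu a; have := hu a; rewrite mxE; case: ifP => _.
    by move=> ?; rewrite mul_mpolyC; apply: dhomogZ.
  by move=> /eqP ->; rewrite mulr0.
pose coord (v : 'rV[S]_(frank F i)) : 'rV[k]_#|I| :=
  \row_(a < #|I|) (v 0 (@enum_val I predT a).1)@_((@enum_val I predT a).2).
refine (@quotient_dim_exists k n (frank F i) #|I| (@tor_cycle k n J F i j)
  (@tor_boundary k n J F i j) coord _ _ _ _ _ _ _).
- split=> //; clear coord I; case: i => // i b.
  by rewrite mul0mx mxE; apply: ideal0.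
- move=> u v [hu Ju] [hv Jv]; split; first exact: ZD.
  clear coord I; case: i u v hu Ju hv Jv => // i u v hu Ju hv Jv b.
  by rewrite mulmxDl mxE; apply: idealD.
- move=> c u [hu Ju]; split; first exact: ZZ.
  clear coord I; case: i u hu Ju => // i u hu Ju b.
  by rewrite -scalemxAl mxE; apply: idealM.
- split=> //; exists 0; split=> // b.
  by rewrite mul0mx subr0 mxE; apply: ideal0.
- move=> c u [hu [w [hw Jw]]]; split; first exact: ZZ.
  exists (c%:MP *: w); split; first exact: ZZ.
  by move=> b; rewrite -scalemxAl -scalerBr mxE; apply: idealM.
- move=> m c z; apply/rowP => a; rewrite !mxE summxE raddf_sum summxE.
  by apply: eq_bigr => l _; rewrite !mxE /= mcoeffCM.
- move=> v [hv _] c0; apply/rowP => a; rewrite mxE; apply/mpolyP => m.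
  rewrite mcoeff0; have := hv a; case: ifP => _; last by move=> /eqP ->; rewrite mcoeff0.
  move=> hva; have [mE | mN] := eqVneq (mdeg m) (j - shift a)%N; last first.
    exact: dhomog_nemf_coeff hva mN.
  have lt_m : (mdeg m < j.+1)%N by rewrite mE ltnS leq_subr.
  have := congr1 (fun u : 'rV_#|I| => u 0 (enum_rank (a, BMultinom lt_m))) c0.
  by rewrite !mxE enum_rankK.
Qed.

Lemma in_degree_koszul i e (v : 'rV[S]_(kr i.+1)) :
  in_degree (@shift _ _ (koszul k n) i) (i + e) v <-> inrow (hfam e) v.
Proof.
by split=> hv a; have := hv a; rewrite /= leq_addr addKn.
Qed.

Lemma qvanish_tor i e : qvanish J i e <->
  forall v, @tor_cycle k n J (koszul k n) i (i + e.+1) v ->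
            @tor_boundary k n J (koszul k n) i (i + e.+1) v.
Proof.
have gh := gmod_hfam k n.
have Jsub d m (v : 'rV[S]_m) : inrow (hfam d) v -> (forall b, J (v 0 b)) ->
    inrow (ifam J d) v by move=> hv Jv b; split; [apply: hv | apply: Jv].
split=> van v.
- case=> /in_degree_koszul hv Jv; split; first exact/in_degree_koszul.
  have [|w [hw Jw]] := van v hv.
    case: i v hv Jv {van} => [|i] v hv Jv; first by move=> [j lt_j]; exfalso; rewrite krank0 in lt_j.
    by apply: Jsub => //; apply: inrow_kdiff.
  exists w; split; last by move=> b; case: (Jw b).
  by rewrite addnS -addSn; apply/in_degree_koszul.
- move=> hv Jv; have [|_ [w [hw Jw]]] := van v.
    split; first exact/in_degree_koszul.
    by case: i v hv Jv {van} => // i v hv Jv b; case: (Jv b).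
  move: hw; rewrite addnS -addSn => /in_degree_koszul hw; exists w; split=> //.
  apply: Jsub => //; apply: inrowB => //; first exact: gh.1.
  exact: inrow_kdiff.
Qed.

(** Strand [r.-1] is the internal degree [i + r], where the maximum has to be attained. For [r = 0]
    there is no such strand; the witness is then the class of 1 in [Tor_0], nonzero because the
    ideal is proper. *)
Lemma regularity_intro r :
  ~ J 1 -> (forall i e, (r <= e)%N -> qvanish J i e) ->
  r = 0%N \/ (exists i, ~ qvanish J i r.-1) -> regularity J r.
Proof.
move=> J1 van nvan; exists (koszul k n); split; first exact: koszul_resolves_k.
  case: r van nvan => [|r] van nvan.
    have [m bm] := betti_exists (koszul k n) 0 0.
    exists 0%N, 0%N, m; split=> //.
    apply: (quotient_dim_neq0 (v := const_mx 1) bm).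
      by split=> // a; rewrite mxE /=; apply: dhomog1.
    move=> [_ [w [hw Jw]]]; apply: J1.
    (* The basis of [F_1] has degree 1, so [F_1] is zero in degree 0. *)
    have w0 : w = 0.
      by apply/rowP => a; rewrite mxE; have /eqP := hw a.
    by have := Jw (krank1_inh k n); rewrite w0 mul0mx subr0 mxE.
  case: nvan => // -[i /= nv].
  have [m bm] := betti_exists (koszul k n) i (i + r.+1).
  exists i, (i + r.+1)%N, m; split=> //.
  apply: NNPP => m0; apply: nv; apply/qvanish_tor => v Zv; apply: NNPP => nB.
  by apply: m0; apply: quotient_dim_neq0 bm Zv nB.
move=> i j m bm m0; rewrite leqNgt; apply/negP => lt_j.
have [e je le_re] : exists2 e, j = (i + e.+1)%N & (r <= e)%N.
  exists (r + (j - (i + r).+1))%N; last exact: leq_addr.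
  by rewrite addnS addnA -addSn subnKC.
move/eqP: m0; apply; apply: quotient_dim_0 bm _; rewrite je.
by apply/qvanish_tor; apply: van.
Qed.

(** The bound is lowered as long as the strand below it vanishes. The facts about strands are
    returned along with [r], since [regularity] speaks of an unspecified resolution. *)
Lemma regularity_exists D : ~ J 1 -> (forall i e, (D <= e)%N -> qvanish J i e) ->
  exists r, [/\ regularity J r, forall i e, (r <= e)%N -> qvanish J i e &
    r = 0%N \/ (exists i, ~ qvanish J i r.-1)].
Proof.
move=> J1; elim: D => [|D IHD] van.
  by exists 0%N; split=> //; [apply: regularity_intro => //|]; left.
have [vD | nvD] := classic (forall i, qvanish J i D).
  apply: IHD => i e; rewrite leq_eqVlt => /orP[/eqP <-|]; [exact: vD | exact: van].
have nv : exists i, ~ qvanish J i D.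
  by apply: NNPP => ne; apply: nvD => i; apply: NNPP => ni; apply: ne; exists i.
by exists D.+1; split=> //; [apply: regularity_intro => //|]; right.
Qed.
End Betti.
(** * Finiteness of the regularity *)

(** Each next index is chosen where [u] attains its minimum over the remaining tail. *)
Lemma monotone_subsequence (u : nat -> nat) :
  exists f : nat -> nat, (forall i, (f i < f i.+1)%N) /\
                         forall i, (u (f i) <= u (f i.+1))%N.
Proof.
have tail_min v a : (u a <= v)%N ->
    exists b, (a <= b)%N /\ forall c, (b <= c)%N -> (u b <= u c)%N.
  elim: v a => [|v IHv] a le_v.
    by exists a; split=> // c _; rewrite (leq_trans le_v).
  have [min_a | ] := classic (forall c, (a <= c)%N -> (u a <= u c)%N); first by exists a.
  move=> /not_all_ex_not[c nc]; have [le_ac /negP] := imply_to_and _ _ nc.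
  rewrite -ltnNge => lt_c.
  have [|b [le_cb min_b]] := IHv c; first by rewrite -ltnS (leq_trans lt_c).
  by exists b; split=> //; apply: leq_trans le_cb.
have nextP a := constructive_indefinite_description _ (tail_min _ a (leqnn _)).
pose next a := sval (nextP a).
have nextE a : (a <= next a)%N /\ forall c, (next a <= c)%N -> (u (next a) <= u c)%N.
  by rewrite /next; case: (nextP a).
pose f := fix f i := if i is i'.+1 then next (f i').+1 else next 0%N.
have lt_f i : (f i < f i.+1)%N by case: (nextE (f i).+1).
exists f; split=> // i; have le_f := ltnW (lt_f i).
by case: i le_f => [|i] le_f; [case: (nextE 0%N) | case: (nextE (f i).+1)] => _; apply.
Qed.

Lemma homo_ltn_seq (f : nat -> nat) : (forall i, (f i < f i.+1)%N) ->
  forall i j, (i < j)%N -> (f i < f j)%N.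
Proof. by move=> lt_f; exact: (@homo_ltn _ f (fun a b => a < b)%N (@ltn_trans) lt_f). Qed.

Lemma dickson_subsequence n (m : nat -> 'X_{1..n}) :
  exists f : nat -> nat, (forall i, (f i < f i.+1)%N) /\
    forall i j, (i <= j)%N -> (m (f i) <= m (f j))%MM.
Proof.
suff [f [lt_f le_f]] : exists f : nat -> nat, (forall i, (f i < f i.+1)%N) /\
    forall c, c \in enum 'I_n -> forall i, (m (f i) c <= m (f i.+1) c)%N.
  exists f; split=> // i j le_ij; apply/mnm_lepP => c.
  apply: (@homo_leq _ (fun i => m (f i) c) leq) le_ij => // [y x z|l].
    exact: leq_trans.
  by apply: le_f; rewrite mem_enum.
elim: (enum 'I_n) => [|c l [f [lt_f le_f]]]; first by exists id.
have [h [lt_h le_h]] := monotone_subsequence (fun i => m (f i) c).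
exists (f \o h); split=> [i | b]; first exact: homo_ltn_seq lt_f _ _ (lt_h i).
rewrite inE => /orP[/eqP -> // | l_b] i /=.
apply: (@homo_leq _ (fun i => m (f i) b) leq) (ltnW (lt_h i)) => // [y x z|j].
  exact: leq_trans.
exact: le_f.
Qed.

(** Otherwise there are elements of [U] of arbitrarily large degree that are minimal under removal
    of a variable. By [dickson_subsequence] one of them properly divides another, and a variable can
    be removed from the cofactor. *)
Lemma dickson n (U : 'X_{1..n} -> Prop) :
  (forall i m, U m -> U (U_(i) + m)%MM) ->
  exists D, forall m, (D < mdeg m)%N -> U m ->
    exists i m', U m' /\ m = (U_(i) + m')%MM.
Proof.
move=> up; apply: NNPP => noD.
pose bad D m := [/\ (D < mdeg m)%N, U m & forall i m', U m' -> m <> (U_(i) + m')%MM].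
have badP D : exists m, bad D m.
  apply: NNPP => nbad; apply: noD; exists D => m lt_D Um; apply: NNPP => ni.
  by apply: nbad; exists m; split=> // i m' Um' mE; apply: ni; exists i, m'.
pose m D := sval (constructive_indefinite_description _ (badP D)).
have mP D : bad D (m D) by rewrite /m; case: constructive_indefinite_description.
have [f [lt_f le_f]] := dickson_subsequence m.
have f_ge i : (i <= f i)%N.
  by elim: i => // i IHi; apply: leq_ltn_trans IHi (lt_f i).
(* With [j = mdeg a] the exponent [m (f j)] has larger degree than [a], so their difference is
   nonzero. *)
pose a := m (f 0%N); pose j := mdeg a.
have [lt_j _ min_j] := mP (f j); have [_ Ua _] := mP (f 0%N).
have lt_a : (mdeg a < mdeg (m (f j)))%N by apply: leq_ltn_trans lt_j; apply: f_ge.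
have upD b : U (b + a)%MM.
  move: b; suff up_d d b : mdeg b = d -> U (b + a)%MM by move=> b; apply: up_d.
  elim: d b => [|d IHd] b; first by move/eqP; rewrite mdeg_eq0 => /eqP ->; rewrite add0m.
  move=> bd; have [i bi] : exists i, b i != 0%N.
    apply/existsP; apply: contraPT bd => /existsPn b0.
    suff -> : b = 0%MM by rewrite mdeg0.
    by apply/mnmP => i; rewrite mnm0E; apply/eqP; have := b0 i; rewrite negbK.
  have le_b : (U_(i) <= b)%MM by rewrite lep1mP.
  rewrite -(submK le_b) [(_ + U_(i))%MM]addmC -addmA; apply: up; apply: IHd.
  by move: bd; rewrite -{1}(submK le_b) mdegD mdeg1 addn1 => -[].
have le_a : (a <= m (f j))%MM by apply: le_f.
pose b := (m (f j) - a)%MM.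
have bE : m (f j) = (b + a)%MM by rewrite submK.
have [i bi] : exists i, b i != 0%N.
  apply/existsP; apply: contraLR lt_a => /existsPn b0.
  suff b_0 : b = 0%MM by rewrite bE b_0 add0m ltnn.
  by apply/mnmP => i; rewrite mnm0E; apply/eqP; have := b0 i; rewrite negbK.
have le_b : (U_(i) <= b)%MM by rewrite lep1mP.
apply: (min_j i (b - U_(i) + a)%MM) => //.
by rewrite bE addmA [(U_(i) + _)%MM]addmC submK.
Qed.

Section Finiteness.
Variables (k : fieldType) (n : nat).
Local Notation S := {mpoly k[n]}.

(** Dickson's lemma applies to the leading monomials. In large degree the leading monomial of [p] is
    a variable times that of some [q] in [I d]; subtracting a multiple of this product lowers the
    leading monomial. *)
Lemma graded_ideal_generated (I : nat -> S -> Prop) :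
  (forall d p, I d p -> p \is d.-homog) -> (forall d, I d 0) ->
  (forall d p q, I d p -> I d q -> I d (p + q)) ->
  (forall d c p, I d p -> I d (c *: p)) ->
  (forall d i p, I d p -> I d.+1 ('X_i * p)) ->
  exists D, forall d p, (D <= d)%N -> I d.+1 p ->
    exists u : 'I_n -> S, (forall i, I d (u i)) /\ p = \sum_i 'X_i * u i.
Proof.
move=> hI I0 ID IZ IX.
pose U m := exists p, [/\ I (mdeg m) p, p != 0 & mlead p = m].
have lead_homog d p : I d p -> p != 0 -> mdeg (mlead p) = d.
  by move=> /hI/dhomogP hp p0; apply: hp; apply: mlead_supp.
have [|D DP] := @dickson n U.
  move=> i m [p [Ip p0 pm]]; exists ('X_i * p); split.
  - by rewrite mdegD mdeg1 add1n; apply: IX.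
  - by rewrite mulf_neq0 ?mvar_neq0.
  - by rewrite mleadM ?mvar_neq0 // mleadXm pm.
exists D => d p le_D; elim/mleadrect: p => p IHp Ip.
have [-> | p0] := eqVneq p 0.
  exists (fun _ => 0); split=> // ; rewrite big1 // => i _; exact: mulr0.
have dp := lead_homog _ _ Ip p0.
have [|| i [m [[q [Iq q0 qm]] pm]]] := DP (mlead p); first by rewrite dp.
  by exists p; rewrite dp.
have dm : mdeg m = d by move: dp; rewrite pm mdegD mdeg1 add1n => -[].
rewrite dm in Iq.
pose c := mleadc p / mleadc q.
have XqE : mlead ('X_i * q) = mlead p by rewrite mleadM ?mvar_neq0 // mleadXm qm pm.
have cqE : mleadc ('X_i * q) = mleadc q.
  rewrite mleadM ?mvar_neq0 // mleadXm mulrC addmC; have := mcoeffMX q U_(i) (mlead q).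
  by rewrite mulrC => <-; rewrite addmC mulrC.
have cq0 : mleadc q != 0 by rewrite mleadc_eq0.
pose p' := p - c *: ('X_i * q).
have Ip' : I d.+1 p'.
  by rewrite /p' -scaleNr; apply: ID => //; apply: IZ; apply: IX.
have p'm : p'@_(mlead p) = 0.
  by rewrite mcoeffB mcoeffZ -XqE cqE XqE divfK ?subrr.
have [u [Iu p'E]] : exists u : 'I_n -> S,
    (forall i, I d (u i)) /\ p' = \sum_i 'X_i * u i.
  have [p'0 | p'0] := eqVneq p' 0.
    by exists (fun _ => 0); split=> //; rewrite p'0 big1 // => j _; exact: mulr0.
  apply: IHp => //; rewrite lt_neqAle; apply/andP; split.
    by apply: contraNneq p'0 => E; rewrite -mleadc_eq0 E p'm.
  apply: le_trans (mleadB_le _ _) _; rewrite leUx lexx /=.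
  by rewrite -XqE; apply: mleadZ_le.
exists (fun j => u j + (if j == i then c *: q else 0)); split.
  by move=> j; apply: ID => //; case: ifP => // _; apply: IZ.
under eq_bigr do rewrite mulrDr.
rewrite big_split /= -p'E (bigD1 i) //= eqxx [X in _ + (_ + X)]big1.
  by rewrite addr0 -scalerAr subrK.
by move=> j /negPf ->; rewrite mulr0.
Qed.

(** Induction on the rank: the first coordinates form a graded ideal, and after subtraction only
    rows with first coordinate 0 remain. *)
Lemma graded_module_generated r (M : nat -> 'rV[S]_r -> Prop) :
  (forall d v, M d v -> inrow (hfam d) v) -> (forall d, M d 0) ->
  (forall d v w, M d v -> M d w -> M d (v + w)) ->
  (forall d c v, M d v -> M d (c%:MP *: v)) ->
  (forall d i v, M d v -> M d.+1 ('X_i *: v)) ->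
  exists D, forall d v, (D <= d)%N -> M d.+1 v ->
    exists u : 'I_n -> 'rV_r, (forall i, M d (u i)) /\ v = \sum_i 'X_i *: u i.
Proof.
elim: r M => [|r IHr] M hM M0 MD MZ MX.
  exists 0%N => d v _ Mv; exists (fun _ => 0); split=> //.
  exact: rV_thin.
pose I d p := exists2 v, M d v & v 0 ord0 = p.
have [|||||D1 D1P] := @graded_ideal_generated I.
- by move=> d p [v /hM hv <-]; apply: hv.
- by move=> d; exists 0; rewrite ?mxE.
- by move=> d _ _ [v Mv <-] [w Mw <-]; exists (v + w); rewrite ?mxE //; apply: MD.
- move=> d c _ [v Mv <-]; exists (c%:MP *: v); first exact: MZ.
  by rewrite mxE mul_mpolyC.
- by move=> d i _ [v Mv <-]; exists ('X_i *: v); rewrite ?mxE //; apply: MX.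
pose M' d (v : 'rV[S]_r) := M d (row_mx (0 : 'rV_1) v).
have rD (v w : 'rV[S]_r) : row_mx (0 : 'rV_1) (v + w) = row_mx 0 v + row_mx 0 w.
  by rewrite add_row_mx addr0.
have rZ c (v : 'rV[S]_r) : row_mx (0 : 'rV_1) (c *: v) = c *: row_mx 0 v.
  by rewrite scale_row_mx scaler0.
have [|||||D2 D2P] := IHr M'.
- by move=> d v /hM /(@inrow_row_mx _ _ 1 r)[].
- by move=> d; rewrite /M' row_mx0.
- by move=> d v w Mv Mw; rewrite /M' rD; apply: MD.
- by move=> d c v Mv; rewrite /M' rZ; apply: MZ.
- by move=> d i v Mv; rewrite /M' rZ; apply: MX.
have MS d (J : seq 'I_n) F : (forall i, M d (F i)) -> M d (\sum_(i <- J) F i).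
  by move=> MF; apply: big_ind => // v w; apply: MD.
exists (maxn D1 D2) => d v; rewrite geq_max => /andP[le1 le2] Mv.
have [|u [Iu vE]] := D1P d (v 0 ord0) le1; first by exists v.
have /fin_all_exists2[w Mw wE] := Iu.
pose v1 := v - \sum_i 'X_i *: w i.
have Mv1 : M d.+1 v1.
  apply: MD => //; rewrite -scaleN1r -mpolyC1 -mpolyCN; apply: MZ.
  by apply: MS => i; apply: MX.
have v1E : v1 = row_mx (0 : 'rV_1) (rsubmx (v1 : 'rV_(1 + r))).
  suff l0 : lsubmx (v1 : 'rV_(1 + r)) = 0 by rewrite -l0 hsubmxK.
  apply/rowP => j; rewrite !mxE ord1.
  have -> : lshift r 0 = ord0 :> 'I_(1 + r) by apply: val_inj.
  rewrite vE summxE; apply/eqP; rewrite subr_eq0; apply/eqP; apply: eq_bigr => i _.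
  by rewrite mxE wE.
have [|u' [Mu' u'E]] := D2P d (rsubmx (v1 : 'rV_(1 + r))) le2.
  by rewrite /M' -v1E.
exists (fun i => w i + row_mx (0 : 'rV_1) (u' i)); split.
  by move=> i; apply: MD; [apply: Mw | apply: Mu'].
under eq_bigr do rewrite scalerDr.
rewrite big_split /= addrC -[LHS](subrK (\sum_i 'X_i *: w i)); congr (_ + _).
rewrite -/v1 v1E u'E.
apply/rowP => j; rewrite summxE -(splitK (j : 'I_(1 + r))); case: split => a /=.
  rewrite [LHS]row_mxEl mxE big1 // => i _.
  by rewrite mxE [X in _ * X]row_mxEl mxE mulr0.
rewrite [LHS]row_mxEr summxE; apply: eq_bigr => i _.
by rewrite [LHS]mxE [RHS]mxE [X in _ = _ * X]row_mxEr.
Qed.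

(** In large degree a cycle modulo the ideal is a sum of products ['X_j *: u j] with cycles [u j],
    and multiplication by a variable is homotopic to 0. *)
Theorem regularity_finite (g : S -> Prop) :
  exists D, forall i e, (D <= e)%N -> qvanish (ideal g) i e.
Proof.
have gh := gmod_hfam k n; have gJ := gmod_ifam g.
pose X := vars k n.
have van i : exists D, forall e, (D <= e)%N -> qvanish (ideal g) i e.
  pose M d (v : 'rV[S]_(krank (size X) i.+1)) :=
    inrow (hfam d) v /\ inrow (ifam (ideal g) d.+1) (v *m kdiff X i).
  have [|||||D DP] := @graded_module_generated _ M.
  - by move=> d v [].
  - move=> d; split; first by apply: inrow0; apply: gh.1.
    by rewrite mul0mx; apply: inrow0; apply: gJ.1.
  - move=> d v w [hv Jv] [hw Jw]; split; first by apply: inrowD => //; apply: gh.1.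
    by rewrite mulmxDl; apply: inrowD => //; apply: gJ.1.
  - move=> d c v [hv Jv]; split.
      by apply: inrowZ hv => p; rewrite mul_mpolyC; apply: dhomogZ.
    rewrite -scalemxAl; apply: inrowZ Jv => p [hp Ip].
    by split; [rewrite mul_mpolyC; apply: dhomogZ | apply: idealM].
  - move=> d j v [hv Jv]; split.
      by apply: inrowZ hv => p; apply: gh.2; apply: mem_vars.
    rewrite -scalemxAl; apply: inrowZ Jv => p; apply: gJ.2; exact: mem_vars.
  exists D => e le_D v hv Jv; have [//|u [Mu vE]] := DP e v le_D.
  have hJ j : exists w : 'rV_(krank (size X) i.+2), inrow (hfam e) w /\
      inrow (ifam (ideal g) e.+1) ('X_j *: u j - w *m kdiff X i.+1).
    have [h [hp hE]] := kdiff_homotopy (mem_vars k j).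
    have [hu Ju] := Mu j; exists (u j *m h i.+1); split.
      by apply: hp hu; apply: gh.1.
    rewrite -mul_mx_scalar -hE mulmxDr !mulmxA addrC addKr.
    by apply: hp Ju; apply: gJ.1.
  have /fin_all_exists[w wP] := hJ; exists (\sum_j w j); split.
    apply: (big_ind (fun w => inrow (hfam e) w)) => [|x y|j _]; last by case: (wP j).
      by apply: inrow0; apply: gh.1.
    by apply: inrowD; apply: gh.1.
  rewrite vE -/(kdiff _ _) mulmx_suml -sumrB.
  apply: (big_ind (fun w => inrow (ifam (ideal g) e.+1) w)) => [|x y|j _]; last by case: (wP j).
    by apply: inrow0; apply: gJ.1.
  by apply: inrowD; apply: gJ.1.
have [f fP] : exists f : nat -> nat, forall i e, (f i <= e)%N -> qvanish (ideal g) i e.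
  exists (fun i => sval (constructive_indefinite_description _ (van i))) => i.
  by case: constructive_indefinite_description.
(* The complex is zero in homological degrees above the number of variables, so finitely many bounds
   suffice. *)
exists (\max_(i < (size X).+1) f i)%N => i e le_e.
have [lt_i | le_i] := ltnP i (size X).+1.
  by apply: fP; apply: leq_trans le_e; apply: (leq_bigmax (Ordinal lt_i)).
move=> v _ _; exists 0; split; first by apply: inrow0; apply: gh.1.
rewrite [_ - _](@rV_thin _ _ _ 0) ?krank_gt //; first by apply: inrow0; apply: gJ.1.
Qed.
End Finiteness.
(** * Binomial edge ideals of cliques *)

Section QuotientStrands.
Variables (k : fieldType) (n : nat).
Local Notation S := {mpoly k[n]}.
Implicit Types (g : S -> Prop) (Z : pred 'I_n).

Definition graded g := forall x, g x -> exists e, x \is e.-homog.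

Lemma ideal_split g g' (z p : S) : (forall x, g' x -> g x \/ x = z) ->
  ideal g' p -> exists b u, ideal g b /\ p = b + z * u.
Proof.
move=> g'E; elim=> [|c x {}p g'x _ [b [u [Ib ->]]]].
  by exists 0, 0; split; [apply: ideal0 | rewrite mulr0 addr0].
have [gx | ->] := g'E _ g'x.
  by exists (c * x + b), u; rewrite addrA; split=> //; apply: idealS.
by exists b, (u + c); split=> //; rewrite addrCA mulrDr [c * z]mulrC addrCA addrC addrA addrAC.
Qed.

Lemma ifam_split g g' (z : S) d p : graded g -> z \is 1.-homog ->
  (forall x, g' x -> g x \/ x = z) -> ifam (ideal g') d.+1 p ->
  exists b u, [/\ ifam (ideal g) d.+1 b, hfam d u & p = b + z * u].
Proof.
move=> gr z1 g'E [hp /(ideal_split g'E)[b [u [Ib pE]]]].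
exists (pihomog mdeg d.+1 b), (pihomog mdeg d u); split.
- by split; [apply: pihomogP | apply: ideal_pihomog].
- exact: pihomogP.
- rewrite -(pihomog_dE hp) pE pihomogD; congr (_ + _).
  by rewrite mulrC (pihomogMh _ _ z1) /= subn1 mulrC.
Qed.

Lemma kvanish_congr (s : seq S) A B B' i e : (forall d p, B d p <-> B' d p) ->
  kvanish s A B i e -> kvanish s A B' i e.
Proof.
move=> BB' van v Av B'v; have [|w [Aw Bw]] := van v Av.
  by move=> j; apply/BB'; apply: B'v.
by exists w; split=> // j; apply/BB'; apply: Bw.
Qed.

Lemma qvanish_congr (J J' : S -> Prop) i e : (forall p, J p <-> J' p) ->
  qvanish J i e -> qvanish J' i e.
Proof.
move=> JJ'; apply: kvanish_congr => d p.
by split=> -[hp Jp]; split=> //; apply/JJ'.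
Qed.

Lemma gincl_ifam g g' : (forall x, g x -> ideal g' x) ->
  gincl (ifam (ideal g)) (ifam (ideal g')).
Proof. by move=> gg' d p [hp Ip]; split=> //; apply: ideal_le Ip. Qed.

Lemma gmul_hfam_ifam g z : z \is 1.-homog -> ideal g z ->
  gmul z (@hfam k n) (ifam (ideal g)).
Proof.
move=> z1 Iz d p hp; split; last by rewrite mulrC; apply: idealM.
by rewrite -add1n; apply: dhomogM.
Qed.

Lemma ivars_graded Z : graded (@ivars k n Z).
Proof. by move=> _ [i _ ->]; exists 1%N; apply: homogX. Qed.

(** Starting from the zero ideal, the variables are adjoined one by one; each is not a zero divisor
    modulo the others. *)
Lemma qvanish_ivars Z i e : qvanish (ideal (@ivars k n Z)) i e.
Proof.
have gh := gmod_hfam k n; have gI := @gmod_ifam k n.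
have [m] := ubnP #|Z|; elim: m Z i => // m IHm Z i le_m.
have [j Zj | Z0] := pickP Z; last first.
  apply: qvanish_congr (@kvanish_vars k n i e) => p.
  by split; apply: ideal_le => // x [a]; rewrite Z0.
pose Z' := [pred a | (a != j) && Z a].
have ZE (x : S) : ivars Z x -> ivars Z' x \/ x = 'X_j.
  case=> a Za ->; have [-> | aj] := eqVneq a j; first by right.
  by left; exists a => //=; rewrite aj.
have Xj1 := homogX k j.
have IXj : ideal (@ivars k n Z) 'X_j by apply: idealG; exists j.
apply: (@kvanish_nzd_up _ _ 'X_j _ (ifam (ideal (@ivars k n Z')))) i => //.
- exact: (gI _).1.
- by apply: gincl_ifam => x [a /andP[_ Za] ->]; apply: idealG; exists a.
- by apply: gh.2; apply: mem_vars.
- by apply: (gI _).2; apply: mem_vars.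
- exact: gmul_hfam_ifam.
- by move=> d p; exact: (ifam_split (@ivars_graded _) Xj1 ZE).
- move=> d u hu [_ /ideal_ivars Xu]; split=> //; apply/ideal_ivars.
  by move/eqP: Xu; rewrite rmorphM msubX /kill /= eqxx mulf_eq0 (negPf (mvar_neq0 k j)) => /eqP.
- move=> i'; apply: IHm; rewrite -ltnS; apply: leq_trans le_m; rewrite ltnS.
  rewrite [X in (_ < X)%N](cardD1 j) unfold_in Zj add1n ltnS.
  by apply: subset_leq_card; apply/subsetP => a; rewrite !inE.
Qed.
End QuotientStrands.

(** * Variables indexed by vertices *)

Section VertexVariables.
Variables (k : fieldType) (G : sgraph).
Local Notation N := (#|G| + #|G|)%N.
Local Notation S := {mpoly k[N]}.
Local Notation x := (@xvar k G).
Local Notation y := (@yvar k G).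

Definition ix (v : G) : 'I_N := lshift #|G| (enum_rank v).
Definition iy (v : G) : 'I_N := rshift #|G| (enum_rank v).

Lemma ix_inj : injective ix.
Proof. by move=> u v /lshift_inj/enum_rank_inj. Qed.

Lemma iy_inj : injective iy.
Proof. by move=> u v /rshift_inj/enum_rank_inj. Qed.

Lemma ixy_neq u v : (ix u == iy v) = false.
Proof. exact: eq_lrshift. Qed.

Lemma iyx_neq u v : (iy u == ix v) = false.
Proof. exact: eq_rlshift. Qed.

Lemma index_cases i : (exists v, i = ix v) \/ (exists v, i = iy v).
Proof.
case: (split_ordP i) => a ->; [left | right]; exists (enum_val a);
by rewrite /ix /iy enum_valK.
Qed.

Definition bsub m (hx hy : G -> {mpoly k[m]}) : {rmorphism S -> {mpoly k[m]}} :=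
  msub (fun i => match split i with
                 | inl a => hx (enum_val a) | inr a => hy (enum_val a) end).

Section Bsub.
Variables (m : nat) (hx hy : G -> {mpoly k[m]}).

Lemma bsubx v : bsub hx hy (x v) = hx v.
Proof.
by rewrite /bsub /xvar msubX -[lshift _ _]/(unsplit (inl _)) unsplitK enum_rankK.
Qed.

Lemma bsuby v : bsub hx hy (y v) = hy v.
Proof.
by rewrite /bsub /yvar msubX -[rshift _ _]/(unsplit (inr _)) unsplitK enum_rankK.
Qed.

Lemma bsubC c : bsub hx hy c%:MP = c%:MP.
Proof. exact: msubC. Qed.

Lemma bsub_homog d p : (forall v, hx v \is 1.-homog) ->
  (forall v, hy v \is 1.-homog) -> p \is d.-homog -> bsub hx hy p \is d.-homog.
Proof. by move=> hx1 hy1; apply: msub_homog => i; case: split. Qed.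
End Bsub.

Lemma rmorph_xy_eq m (f g : {rmorphism S -> {mpoly k[m]}}) :
  (forall c, f c%:MP = g c%:MP) -> (forall v, f (x v) = g (x v)) ->
  (forall v, f (y v) = g (y v)) -> f =1 g.
Proof.
move=> fgC fgx fgy; apply: mpoly_rmorph_eq => // i.
by case: (index_cases i) => -[v ->]; [apply: fgx | apply: fgy].
Qed.

Lemma xvar_homog v : x v \is 1.-homog.
Proof. exact: homogX. Qed.

Lemma yvar_homog v : y v \is 1.-homog.
Proof. exact: homogX. Qed.

Definition minor u v : S := x u * y v - y u * x v.

Lemma minor_homog u v : minor u v \is 2.-homog.
Proof.
have h2 (p q : S) : p \is 1.-homog -> q \is 1.-homog -> p * q \is 2.-homog.
  by move=> hp hq; rewrite -[2%N]/(1 + 1)%N; apply: dhomogM.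
by apply: rpredB; apply: h2; rewrite ?xvar_homog ?yvar_homog.
Qed.

Lemma minorE m (f : {rmorphism S -> {mpoly k[m]}}) u v :
  f (minor u v) = f (x u) * f (y v) - f (y u) * f (x v).
Proof. by rewrite rmorphB !rmorphM. Qed.

(** The variables in [Z] are those adjoined when vertices are removed in an induction on a clique;
    for [Z = pred0] an edge ideal remains. *)
Definition bgen (e : rel G) (Z : pred 'I_N) (p : S) : Prop :=
  (exists u v, e u v /\ p = minor u v) \/ ivars Z p.

Lemma bgen_graded e Z : graded (bgen e Z).
Proof.
move=> p [[u [v [_ ->]]] | [i _ ->]].
  by exists 2%N; apply: minor_homog.
by exists 1%N; apply: homogX.
Qed.
End VertexVariables.

Section Cliques.
Variables (k : fieldType) (G : sgraph).
Local Notation N := (#|G| + #|G|)%N.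
Local Notation S := {mpoly k[N]}.
Local Notation T := {mpoly k[N + 1]}.
Local Notation x := (@xvar k G).
Local Notation y := (@yvar k G).
Implicit Types (W : {set G}) (Z : pred 'I_N).

Definition clique_rel W : rel G := fun u v => (u \in W) && (v \in W).

Local Notation clique_gen W Z := (@bgen k G (clique_rel W) Z).

Definition avoids Z W := forall v, v \in W -> Z (ix v) = false /\ Z (iy v) = false.

(* The kernel of [rank1_map W Z] is the ideal generated by [clique_gen W Z]: it
   sends x_v to T y_v for v in W, so that its image is a domain. *)
Definition emb (i : 'I_N) : T := 'X_(lshift 1 i).
Definition tvar : T := 'X_(rshift N ord0).

Definition rank1_map W Z : {rmorphism S -> T} :=
  bsub (fun v => if Z (ix v) then 0
                 else if v \in W then emb (iy v) * tvar else emb (ix v))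
       (fun v => if Z (iy v) then 0 else emb (iy v)).

Lemma rank1C W Z c : rank1_map W Z c%:MP = c%:MP.
Proof. exact: bsubC. Qed.

Lemma rank1x W Z v : rank1_map W Z (x v) =
  if Z (ix v) then 0 else if v \in W then emb (iy v) * tvar else emb (ix v).
Proof. exact: bsubx. Qed.

Lemma rank1y W Z v : rank1_map W Z (y v) = if Z (iy v) then 0 else emb (iy v).
Proof. exact: bsuby. Qed.

(** These are the variables killed by [rank1_map W Z] after setting [T = 0]. For [w] in [W] they
    also generate the colon by [y_w] of the clique ideal with [x_w] adjoined. *)
Definition add_x W Z : pred 'I_N := fun i => Z i || [exists v in W, i == ix v].

Lemma add_x_ix W Z v : add_x W Z (ix v) = Z (ix v) || (v \in W).
Proof.
rewrite /add_x; congr (_ || _); apply/existsP/idP => [[u /andP[uW /eqP/ix_inj ->]] //|vW].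
by exists v; rewrite vW eqxx.
Qed.

Lemma add_x_iy W Z v : add_x W Z (iy v) = Z (iy v).
Proof.
rewrite /add_x orbC; case: existsP => // -[u /andP[_ /eqP/esym/eqP]].
by rewrite ixy_neq.
Qed.

Definition tzero : {rmorphism T -> S} :=
  msub (fun i : 'I_(N + 1) => match split i with inl a => 'X_a | inr _ => 0 end).

Lemma tzero_emb i : tzero (emb i) = 'X_i.
Proof. by rewrite /tzero /emb msubX -[lshift _ _]/(unsplit (inl _)) unsplitK. Qed.

Lemma tzero_tvar : tzero tvar = 0.
Proof. by rewrite /tzero /tvar msubX -[rshift _ _]/(unsplit (inr _)) unsplitK. Qed.

Lemma tzero_rank1 W Z p :
  tzero (rank1_map W Z p) = msub (@kill k N (add_x W Z)) p.
Proof.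
pose f : {rmorphism S -> S} := tzero \o rank1_map W Z.
have fE q : f q = tzero (rank1_map W Z q) by [].
rewrite -fE; move: p; apply: rmorph_xy_eq => [c | v | v]; rewrite fE.
- by rewrite rank1C /tzero !msubC.
- rewrite rank1x [RHS](@msubX _ _ _ _ (ix v)) /kill add_x_ix.
  case: (Z _); first by rewrite rmorph0.
  by case: (v \in W); rewrite ?rmorphM ?tzero_tvar ?mulr0 //= tzero_emb.
- rewrite rank1y [RHS](@msubX _ _ _ _ (iy v)) /kill add_x_iy.
  by case: (Z _); [rewrite rmorph0 | rewrite tzero_emb].
Qed.

Lemma rank1_gen W Z p : avoids Z W -> ideal (clique_gen W Z) p -> rank1_map W Z p = 0.
Proof.
move=> av; elim=> [|c q {}p gq _ IH]; first by rewrite rmorph0.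
rewrite rmorphD rmorphM IH addr0.
case: gq => [[u [v [/andP[uW vW] ->]]] | [i Zi ->]].
  have [Zxu Zyu] := av u uW; have [Zxv Zyv] := av v vW.
  by rewrite minorE !rank1x !rank1y Zxu Zyu Zxv Zyv uW vW mulrAC mulrA subrr mulr0.
case: (index_cases i) Zi => -[v ->] Zi.
  by rewrite -[X in _ * X]/(rank1_map W Z (x v)) rank1x Zi mulr0.
by rewrite -[X in _ * X]/(rank1_map W Z (y v)) rank1y Zi mulr0.
Qed.

Lemma emb_neq0 i : emb i != 0.
Proof. exact: mvar_neq0. Qed.

Lemma tvar_neq0 : tvar != 0.
Proof. exact: mvar_neq0. Qed.

Lemma rank1_x_neq0 W Z w : avoids Z W -> w \in W -> rank1_map W Z (x w) != 0.
Proof.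
move=> av wW; have [Zxw _] := av w wW.
rewrite rank1x Zxw wW; exact: mulf_neq0 (emb_neq0 _) tvar_neq0.
Qed.

Definition pred_add (Z : pred 'I_N) (i : 'I_N) : pred 'I_N := fun j => (j == i) || Z j.

(** Setting the image of [y_w] to 0 also kills the image [T y_w] of [x_w], and what remains is the
    parametrization of the smaller clique. *)
Lemma rank1_restrict W Z w p : avoids Z W -> w \in W -> rank1_map W Z p = 0 ->
  rank1_map (W :\ w) (pred_add (pred_add Z (ix w)) (iy w)) p = 0.
Proof.
move=> av wW p0; set Z' := pred_add _ _.
pose chi : {rmorphism T -> T} :=
  msub (fun i => if i == lshift 1 (iy w) then 0 else 'X_i).
have chiE i : chi (emb i) = if i == iy w then 0 else emb i.
  by rewrite /chi /emb msubX (inj_eq (@lshift_inj _ _)).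
have chiT : chi tvar = tvar by rewrite /chi /tvar msubX eq_rlshift.
pose f : {rmorphism S -> T} := chi \o rank1_map W Z.
have fE q : f q = chi (rank1_map W Z q) by [].
suff f_eq : f =1 rank1_map (W :\ w) Z' by rewrite -f_eq fE p0 rmorph0.
apply: rmorph_xy_eq => [c | v | v]; rewrite fE.
- by rewrite !rank1C /chi msubC.
- rewrite !rank1x /Z' /pred_add ixy_neq (inj_eq (@ix_inj G)) /= !inE.
  have [-> | vw] := eqVneq v w.
    by have [-> _] := av w wW; rewrite wW rmorphM chiE eqxx mul0r.
  rewrite /=; case: (Z _); first by rewrite rmorph0.
  by case: (v \in W); rewrite ?rmorphM chiE ?chiT ?(inj_eq (@iy_inj G)) ?(negPf vw) ?ixy_neq.
- rewrite !rank1y /Z' /pred_add iyx_neq (inj_eq (@iy_inj G)) /=.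
  have [-> | vw] := eqVneq v w.
    by case: (Z _); rewrite ?rmorph0 // chiE eqxx.
  case: (Z _); first by rewrite rmorph0.
  by rewrite chiE (inj_eq (@iy_inj G)) (negPf vw).
Qed.

(** Modulo the clique ideal, [y_w x_v = x_w y_v] for [v] in [W]. *)
Lemma mul_y_add_x W Z w h : w \in W -> ideal (ivars (add_x W Z)) h ->
  exists a c, ideal (clique_gen W Z) a /\ y w * h = a + x w * c.
Proof.
move=> wW; elim=> [|c q {}h [i Zi ->] _ [a [b [Ia hE]]]].
  by exists 0, 0; split; [apply: ideal0 | rewrite !mulr0 addr0].
have X_split : exists a' c', ideal (clique_gen W Z) a' /\ y w * 'X_i = a' + x w * c'.
  case/orP: Zi => [Zi | /existsP[v /andP[vW /eqP ->]]].
    exists (y w * 'X_i), 0; rewrite mulr0 addr0; split=> //.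
    by apply: idealM; apply: idealG; right; exists i.
  exists (- minor k w v), (y v); split; last by rewrite opprB subrK.
  by apply: idealN; apply: idealG; left; exists w, v; rewrite /clique_rel wW.
have [a' [c' [Ia' E]]] := X_split.
exists (c * a' + a), (c * c' + b); split; first by apply: idealD => //; apply: idealM.
rewrite mulrDr hE mulrCA E; set xw := x w.
by rewrite !mulrDr addrACA mulrCA.
Qed.
End Cliques.

(** * Primality and regularity of clique ideals *)

Section CliqueStrands.
Variables (k : fieldType) (G : sgraph).
Local Notation N := (#|G| + #|G|)%N.
Local Notation S := {mpoly k[N]}.
Local Notation x := (@xvar k G).
Local Notation y := (@yvar k G).
Local Notation clique_gen W Z := (@bgen k G (clique_rel W) Z).
Implicit Types (W : {set G}) (Z : pred 'I_N).

Local Notation drop_xy Z w := (pred_add (pred_add Z (ix w)) (iy w)).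
Local Notation phi W Z := (rank1_map k W Z).

Lemma avoids_restrict W Z w : avoids Z W -> avoids (drop_xy Z w) (W :\ w).
Proof.
move=> av v; rewrite !inE => /andP[vw vW]; have [Zx Zy] := av v vW.
rewrite /pred_add ixy_neq iyx_neq !(inj_eq (@ix_inj G)) (inj_eq (@iy_inj G)).
by rewrite (negPf vw) Zx Zy.
Qed.

Lemma clique_gen_restrict W Z w q : clique_gen (W :\ w) Z q -> clique_gen W Z q.
Proof.
case=> [[u [v [/andP[]]]] | Zq]; last by right.
by rewrite !inE => /andP[_ uW] /andP[_ vW] ->; left; exists u, v; rewrite /clique_rel uW vW.
Qed.

Lemma bgen_add (e : rel G) Z i q :
  @bgen k G e (pred_add Z i) q -> @bgen k G e Z q \/ q = 'X_i.
Proof.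
case=> [uv | [j]]; first by left; left.
rewrite /pred_add; case: eqP => [-> _ -> | _ Zj ->]; first by right.
by left; right; exists j.
Qed.

(* With p = j + x_w g + y_w h and j in the ideal of the smaller clique, setting
   T = 0 shows that h lies in the ideal of the x_v (v in W), so that y_w h can be
   replaced by a multiple of x_w, which is not a zero divisor in the image. *)
Lemma rank1_ker W Z d p : avoids Z W -> p \is d.-homog ->
  phi W Z p = 0 -> ideal (clique_gen W Z) p.
Proof.
have [m] := ubnP #|W|; elim: m W Z d p => // m IHm W Z d p le_m av.
elim/ltn_ind: d p => d IHd p hp p0.
have [W0 | [w wW]] := set_0Vmem W.
  have := tzero_rank1 W Z p; rewrite p0 rmorph0 => /esym/ideal_ivars.
  apply: ideal_le => q [i Zi ->]; apply: idealG; right; exists i => //.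
  by case/orP: Zi => // /existsP[v]; rewrite W0 inE.
have : ideal (clique_gen (W :\ w) (drop_xy Z w)) p.
  apply: (IHm _ _ d) hp (rank1_restrict av wW p0); last exact: avoids_restrict.
  by move: le_m; rewrite (cardsD1 w) wW.
move=> /(ideal_split (@bgen_add _ _ _))[b [h [Ib pE]]].
have [b' [g [Ib' bE]]] := ideal_split (@bgen_add _ _ _) Ib.
have Ij : ideal (clique_gen W Z) b'.
  by apply: ideal_le Ib' => q /clique_gen_restrict; apply: idealG.
have hI : ideal (ivars (add_x W Z)) h.
  apply/ideal_ivars; have := tzero_rank1 W Z p; rewrite p0 rmorph0.
  have b'0 : msub (kill k (add_x W Z)) b' = 0.
    by rewrite -tzero_rank1 rank1_gen ?rmorph0.
  rewrite pE bE !rmorphD b'0 add0r !rmorphM !msubX /kill add_x_ix wW orbT mul0r add0r.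
  rewrite add_x_iy; have [_ ->] := av w wW.
  by move/esym/eqP; rewrite mulf_eq0 (negPf (mvar_neq0 k _)) => /eqP.
have [a [c [Ia hE]]] := mul_y_add_x wW hI.
pose J0 := b' + a; pose q := g + c.
have IJ0 : ideal (clique_gen W Z) J0 by apply: idealD.
have pE' : p = J0 + q * x w.
  have -> : p = (b' + x w * g) + y w * h by rewrite pE bE.
  by rewrite hE addrACA [q * _]mulrC mulrDr.
have gr := @bgen_graded k G (clique_rel W) Z.
have IJd : ideal (clique_gen W Z) (pihomog mdeg d J0) by apply: ideal_pihomog.
rewrite -(pihomog_dE hp) pE' pihomogD (pihomogMh _ _ (xvar_homog k w)).
case: ifP => [d1 | _]; last by rewrite addr0.
(* The cofactor of [x_w] has degree [d - 1] and lies in the kernel, because [x_w] has a nonzero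
   image in a domain. *)
apply: idealD => //; rewrite mulrC; apply: idealM; apply: (IHd (d - 1)%N).
- by rewrite subn1 ltn_predL.
- exact: pihomogP.
have := p0; rewrite -(pihomog_dE hp) pE' pihomogD (pihomogMh _ _ (xvar_homog k w)) d1.
rewrite rmorphD (rank1_gen av IJd) add0r rmorphM => /eqP.
by rewrite mulf_eq0 (negPf (rank1_x_neq0 k av wW)) orbF => /eqP.
Qed.

Lemma clique_nzd W Z w d u : avoids Z W -> w \in W -> u \is d.-homog ->
  ideal (clique_gen W Z) (x w * u) -> ideal (clique_gen W Z) u.
Proof.
move=> av wW hu /(rank1_gen av); rewrite rmorphM => /eqP.
rewrite mulf_eq0 (negPf (rank1_x_neq0 k av wW)) /= => /eqP.
exact: rank1_ker av hu.
Qed.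

(** As [x_w] is not a zero divisor, it may be adjoined. Adjoining [y_w] as well leads to the smaller
    clique, and the kernel of this step is the quotient by an ideal of variables, shifted by one
    degree. Such quotients vanish from strand 0 on, and the shift gives the bound [0 < e]. *)
Lemma qvanish_clique W Z i e : avoids Z W -> (0 < e)%N ->
  qvanish (ideal (clique_gen W Z)) i e.
Proof.
move=> av; case: e => // e _.
have gh := gmod_hfam k N; have gI := @gmod_ifam k N.
have [m] := ubnP #|W|; elim: m W Z av i => // m IHm W Z av i le_m.
have [W0 | [w wW]] := set_0Vmem W.
  apply: qvanish_congr (@qvanish_ivars k N Z i e.+1) => p; split; apply: ideal_le => q.
    by move=> Zq; apply: idealG; right.
  case=> [[u [v [/andP[uW]]]] | Zq]; last exact: idealG.
  by rewrite W0 inE in uW.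
pose Zx := pred_add Z (ix w).
have hx := xvar_homog k w; have hy := yvar_homog k w.
have Ix : ideal (clique_gen W Zx) (x w).
  by apply: idealG; right; exists (ix w); rewrite ?/Zx /pred_add ?eqxx.
have sub_x q : clique_gen W Z q -> ideal (clique_gen W Zx) q.
  case=> [uv | [j Zj ->]]; apply: idealG; first by left.
  by right; exists j; rewrite // /Zx /pred_add Zj orbT.
apply: (@kvanish_nzd_down _ _ (x w) _ (ifam (ideal (clique_gen W Z)))
  (ifam (ideal (clique_gen W Zx)))) => //.
- exact: mem_vars.
- exact: gincl_ifam.
- exact: gmul_hfam_ifam.
- by move=> d p; exact: (ifam_split (@bgen_graded _ _ _ _) hx (@bgen_add _ _ _)).
- by move=> d u hu [_ /(clique_nzd av wW hu)].
pose Zxy := drop_xy Z w.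
have XY : gincl (ifam (ideal (clique_gen W Zx))) (ifam (ideal (clique_gen (W :\ w) Zxy))).
  apply: gincl_ifam => q [[u [v [/andP[uW vW] ->]]] | [j Zj ->]]; last first.
    by apply: idealG; right; exists j => //; apply/orP; right.
  have Iw : ideal (clique_gen (W :\ w) Zxy) (x w) /\ ideal (clique_gen (W :\ w) Zxy) (y w).
    split; apply: idealG; right; [exists (ix w) | exists (iy w)] => //;
    by rewrite /Zxy /pred_add eqxx ?orbT.
  have [uw | uw] := eqVneq u w.
    by rewrite uw /minor; apply: idealB; rewrite mulrC; apply: idealM; case: Iw.
  have [vw | vw] := eqVneq v w.
    by rewrite vw /minor; apply: idealB; apply: idealM; case: Iw.
  by apply: idealG; left; exists u, v; rewrite /clique_rel !inE uw vw uW vW.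
apply: (@kvanish_ext _ _ (ifam (ideal (clique_gen W Zx)))
  (ifam (ideal (clique_gen (W :\ w) Zxy))) (@hfam k N)) => //.
- exact: (gI _).1.
- exact: (gI _).1.
- exact: gh.1.
- by move=> d p [].
- apply: (@kvanish_shift _ _ (y w) (ifam (ideal (ivars (add_x W Z)))) _ _ (@hfam k N)) => //.
  + move=> d p [hp /(mul_y_add_x wW)[a [c [Ia E]]]].
    split; first by rewrite -add1n; apply: dhomogM.
    rewrite E; apply: idealD; last by rewrite mulrC; apply: idealM.
    exact: ideal_le Ia.
  + apply: gmul_hfam_ifam => //; apply: idealG; right; exists (iy w) => //.
    by rewrite /Zxy /pred_add eqxx.
  + move=> d p; apply: ifam_split hy _; first exact: bgen_graded.
    move=> q /bgen_add[/clique_gen_restrict|->]; by [left | right].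
  + move=> d g hg [_ Iyg]; split=> //; apply/ideal_ivars.
    have K0 q : ideal (clique_gen W Zx) q -> msub (kill k (add_x W Z)) q = 0.
      elim=> [|c q' {}q gq _ IH]; first by rewrite rmorph0.
      rewrite rmorphD rmorphM IH addr0; apply/eqP; rewrite mulf_eq0; apply/orP; right.
      case: gq => [[u [v [/andP[uW vW] ->]]] | [j Zj ->]].
        by rewrite minorE !msubX /kill !add_x_ix uW vW !orbT mul0r mulr0 subrr.
      rewrite msubX /kill /add_x; case/orP: Zj => [/eqP -> | ->] //.
      by rewrite -[_ || _]/(add_x W Z (ix w)) add_x_ix wW orbT.
    move/eqP: (K0 _ Iyg); rewrite rmorphM msubX /kill add_x_iy.
    by have [_ ->] := av w wW; rewrite mulf_eq0 (negPf (mvar_neq0 k _)) => /eqP.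
  + exact: qvanish_ivars.
- apply: IHm; first exact: avoids_restrict.
  by move: le_m; rewrite (cardsD1 w) wW.
Qed.
End CliqueStrands.
(** * Induced subgraphs and completions *)

Lemma mpolyX_var_inj (k : fieldType) n : injective (fun i : 'I_n => 'X_i : {mpoly k[n]}).
Proof.
move=> i j /(congr1 (mcoeff U_(i))); rewrite !mcoeffX eqxx.
have [/eqP | _ /eqP] := eqVneq U_(j)%MM U_(i)%MM; last by rewrite oner_eq0.
by rewrite eq_mnm1 => /eqP ->.
Qed.

Lemma vars_uniq (k : fieldType) n : uniq (vars k n).
Proof. by rewrite map_inj_uniq ?enum_uniq //; apply: mpolyX_var_inj. Qed.

Lemma rmorph_ideal (k : fieldType) n (f : {rmorphism {mpoly k[n]} -> {mpoly k[n]}}) p :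
  (forall c, f c%:MP = c%:MP) ->
  ideal (fun z => exists i, z = 'X_i - f 'X_i) (p - f p).
Proof.
move=> fC; pose g i := f 'X_i.
have fE : f =1 msub g.
  by apply: mpoly_rmorph_eq => [c | i]; rewrite ?msubC ?msubX.
by rewrite fE; apply: ideal_le (msub_ideal g p) => _ [i ->]; apply: idealG; exists i.
Qed.

Definition edge_gen (k : fieldType) (G : sgraph) (e : rel G) := @bgen k G e pred0.
Arguments edge_gen k {G} e _.

Lemma bei_ideal (k : fieldType) (G : sgraph) p :
  @bei k G p <-> ideal (edge_gen k (@edge G)) p.
Proof.
split=> [[c ->] | ].
  apply: ideal_sum => -[u v] /= uv; apply: idealM; apply: idealG.
  by left; exists u, v.
elim=> [|c _ {}p [[u [v [uv ->]]] | []//] _ [c' ->]].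
  by exists (fun _ => 0); rewrite big1 // => uv _; exact: mul0r.
exists (fun ab => (if ab == (u, v) then c else 0) + c' ab).
under [RHS]eq_bigr do rewrite mulrDl.
rewrite big_split /= [X in _ = X + _](bigD1 (u, v)) //= eqxx [X in _ = _ + X + _]big1 ?addr0 //.
by move=> ab /andP[_ /negPf ->]; rewrite mul0r.
Qed.

Section Embedding.
Variables (k : fieldType) (H G : sgraph) (h : H -> G).
Hypothesis h_inj : injective h.
Local Notation NG := (#|G| + #|G|)%N.
Local Notation NH := (#|H| + #|H|)%N.
Local Notation xG := (@xvar k G).
Local Notation yG := (@yvar k G).
Local Notation xH := (@xvar k H).
Local Notation yH := (@yvar k H).

Definition emb_in : {rmorphism {mpoly k[NH]} -> {mpoly k[NG]}} :=
  @bsub k H _ (fun u => xG (h u)) (fun u => yG (h u)).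

Definition emb_out : {rmorphism {mpoly k[NG]} -> {mpoly k[NH]}} :=
  @bsub k G _ (fun v => oapp xH 0 [pick u | h u == v])
              (fun v => oapp yH 0 [pick u | h u == v]).

Local Notation iota := emb_in.
Local Notation rho := emb_out.
Local Notation im v := (v \in codom h).

Lemma pick_h u : [pick u' | h u' == h u] = Some u.
Proof. by case: pickP => [u' /eqP/h_inj -> // | /(_ u)]; rewrite eqxx. Qed.

Lemma pick_out v : ~~ im v -> [pick u | h u == v] = None.
Proof. by move=> nim; case: pickP => // u /eqP uv; rewrite -uv codom_f in nim. Qed.

Lemma emb_inx u : iota (xH u) = xG (h u). Proof. exact: bsubx. Qed.
Lemma emb_iny u : iota (yH u) = yG (h u). Proof. exact: bsuby. Qed.
Lemma emb_inC c : iota c%:MP = c%:MP. Proof. exact: bsubC. Qed.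
Lemma emb_outC c : rho c%:MP = c%:MP. Proof. exact: bsubC. Qed.
Lemma emb_outx u : rho (xG (h u)) = xH u.
Proof. by rewrite [LHS]bsubx pick_h. Qed.
Lemma emb_outy u : rho (yG (h u)) = yH u.
Proof. by rewrite [LHS]bsuby pick_h. Qed.
Lemma emb_outx0 v : ~~ im v -> rho (xG v) = 0.
Proof. by move=> nim; rewrite [LHS]bsubx pick_out. Qed.
Lemma emb_outy0 v : ~~ im v -> rho (yG v) = 0.
Proof. by move=> nim; rewrite [LHS]bsuby pick_out. Qed.

Lemma emb_inK : cancel iota rho.
Proof.
pose f : {rmorphism {mpoly k[NH]} -> {mpoly k[NH]}} := rho \o iota.
pose g : {rmorphism {mpoly k[NH]} -> {mpoly k[NH]}} := idfun.
have fE p : f p = rho (iota p) by [].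
move=> p; rewrite -fE -[RHS]/(g p); move: p; apply: rmorph_xy_eq => *; rewrite fE.
- by rewrite emb_inC emb_outC.
- by rewrite emb_inx emb_outx.
- by rewrite emb_iny emb_outy.
Qed.

Lemma emb_in_homog d p : p \is d.-homog -> iota p \is d.-homog.
Proof. by apply: bsub_homog => u; [apply: xvar_homog | apply: yvar_homog]. Qed.

Lemma emb_out_homog d p : p \is d.-homog -> rho p \is d.-homog.
Proof.
by apply: bsub_homog => v; case: pickP => [u _|_] /=;
  rewrite ?dhomog0 ?xvar_homog ?yvar_homog.
Qed.

Definition outer_vars := [seq z <- vars k NG | z \notin map iota (vars k NH)].

Lemma outer_varsP z : z \in outer_vars ->
  exists2 w, ~~ im w & z = xG w \/ z = yG w.
Proof.
rewrite mem_filter => /andP[nin /mapP[i _ zE]]; move: nin; rewrite {}zE.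
have nim w : w \in codom h -> xG w \in map iota (vars k NH) /\ yG w \in map iota (vars k NH).
  case/codomP => u ->; rewrite -emb_inx -emb_iny.
  by split; apply: map_f; apply: mem_vars.
case: (index_cases i) => -[w ->] nin; exists w; try by [left | right].
  by apply: contra nin => /nim[].
by apply: contra nin => /nim[].
Qed.

Lemma outer_vars_perm : perm_eq (outer_vars ++ map iota (vars k NH)) (vars k NG).
Proof.
apply: uniq_perm; last 2 first.
- exact: vars_uniq.
- move=> z; rewrite mem_cat mem_filter; case: (boolP (z \in map _ _)) => //= [|_].
    case/mapP => _ /mapP[i _ ->] ->; apply/esym.
    case: (index_cases i) => -[u ->]; first by rewrite [iota _]emb_inx; apply: mem_vars.
    by rewrite [iota _]emb_iny; apply: mem_vars.
  by rewrite orbF.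
rewrite cat_uniq filter_uniq ?vars_uniq // map_inj_uniq ?vars_uniq ?andbT /=; last first.
  exact: can_inj emb_inK.
by apply/hasPn => z zin; rewrite mem_filter zin.
Qed.

Lemma emb_out_minor u v : rho (minor k (h u) (h v)) = minor k u v.
Proof. by rewrite minorE !emb_outx !emb_outy. Qed.

Lemma emb_out_minor0 u v : ~~ (im u && im v) -> rho (minor k u v) = 0.
Proof.
rewrite negb_and minorE => /orP[nim|nim].
  by rewrite (emb_outx0 nim) (emb_outy0 nim) !mul0r subrr.
by rewrite (emb_outx0 nim) (emb_outy0 nim) !mulr0 subrr.
Qed.

Lemma emb_in_minor u v : iota (minor k u v) = minor k (h u) (h v).
Proof. by rewrite minorE !emb_inx !emb_iny. Qed.

Lemma emb_out_ideal (e : rel G) (e' : rel H) p : (forall u v, e (h u) (h v) -> e' u v) ->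
  ideal (edge_gen k e) p -> ideal (edge_gen k e') (rho p).
Proof.
move=> ee'; apply: ideal_map => _ [[u [v [uv ->]]] | [i []//]].
have [/andP[/codomP[a uE] /codomP[b vE]] | nim] := boolP (im u && im v).
  rewrite uE vE emb_out_minor; apply: idealG; left; exists a, b; split=> //.
  by apply: ee'; rewrite -uE -vE.
by rewrite emb_out_minor0 //; apply: ideal0.
Qed.

Lemma emb_in_ideal (e : rel G) (e' : rel H) p : (forall u v, e' u v -> e (h u) (h v)) ->
  ideal (edge_gen k e') p -> ideal (edge_gen k e) (iota p).
Proof.
move=> e'e; apply: ideal_map => _ [[u [v [uv ->]]] | [i []//]].
rewrite emb_in_minor; apply: idealG; left; exists (h u), (h v); split=> //.
exact: e'e.
Qed.

Lemma qvanish_induced (e : rel G) (e' : rel H) i d :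
  (forall u v, e (h u) (h v) = e' u v) ->
  qvanish (ideal (edge_gen k e)) i d -> qvanish (ideal (edge_gen k e')) i d.
Proof.
move=> ee' van; have [gh gI] := (gmod_hfam k NG, @gmod_ifam k NG).
apply: (@kvanish_retract _ _ iota rho outer_vars _ (@hfam k NG) (ifam (ideal (edge_gen k e)))).
- exact: gh.1.
- exact: (gI _).1.
- exact: emb_inK.
- by move=> z /outer_varsP[w nim [->|->]]; [apply: emb_outx0 | apply: emb_outy0].
- by move=> j p; apply: emb_out_homog.
- move=> j p [hp Ip]; split; first exact: emb_out_homog.
  by apply: emb_out_ideal Ip => u v; rewrite ee'.
- by move=> j p; apply: emb_in_homog.
- move=> j p [hp Ip]; split; first exact: emb_in_homog.
  by apply: emb_in_ideal Ip => u v; rewrite ee'.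
- apply: kvanish_perm van; [exact: gh.1 | exact: (gI _).1 | rewrite perm_sym; exact: outer_vars_perm].
Qed.

Definition complete_on (e : rel G) : rel G := fun u v => e u v || im u && im v.

(* x_w f_uv = x_u f_wv - x_v f_wu, so the variables of the vertices outside the
   image annihilate the quotient of the two edge ideals. *)
Lemma outer_minor (e : rel G) u v w : e w u -> e w v ->
  ideal (edge_gen k e) (xG w * minor k u v) /\ ideal (edge_gen k e) (yG w * minor k u v).
Proof.
move=> wu wv; have [Iu Iv] : ideal (edge_gen k e) (minor k w u) /\ ideal (edge_gen k e) (minor k w v).
  by split; apply: idealG; left; [exists w, u | exists w, v].
have E (z : {mpoly k[NG]}) a b : z * minor k u v = a * minor k w v - b * minor k w u ->
    ideal (edge_gen k e) (z * minor k u v).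
  by move=> ->; apply: idealB; apply: idealM.
split.
  apply: (E _ (xG u) (xG v)); rewrite /minor.
  ring.
apply: (E _ (yG u) (yG v)); rewrite /minor.
ring.
Qed.

(** In a multiple of a minor inside the image, the coefficient [c] can be replaced by
    [iota (rho c)], since the outer variables carry the minor into the smaller ideal. The other
    generators already lie in that ideal and are killed by [rho]. *)
Lemma complete_on_split (e : rel G) p :
  (forall w u, ~~ im w -> im u -> e w u) ->
  ideal (edge_gen k (complete_on e)) p -> ideal (edge_gen k e) (p - iota (rho p)).
Proof.
move=> outer; elim=> [|c g {}p gg _ IH].
  by rewrite !rmorph0 subrr; apply: ideal0.
pose f : {rmorphism {mpoly k[NG]} -> {mpoly k[NG]}} := iota \o rho.
have fE q : f q = iota (rho q) by [].
have -> : c * g + p - iota (rho (c * g + p)) = (c * g - f c * f g) + (p - iota (rho p)).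
  have -> : iota (rho (c * g + p)) = f c * f g + f p.
    by rewrite -(GRing.rmorphM f) -(GRing.rmorphD f).
  by rewrite opprD addrACA.
apply: idealD => //.
case: gg => [[u [v [uv ->]]] | [i []//]].
have [/andP[imu imv] | nim] := boolP (im u && im v).
  have -> : f (minor k u v) = minor k u v.
    by case/codomP: imu => a ->; case/codomP: imv => b ->; rewrite fE emb_out_minor emb_in_minor.
  rewrite -mulrBl.
  have fC a : f a%:MP = a%:MP by rewrite fE emb_outC emb_inC.
  elim: (rmorph_ideal c fC) => [|a z q [i ->] _ IHq]; first by rewrite mul0r; apply: ideal0.
  rewrite mulrDl -mulrA; apply: idealD => //; apply: idealM.
  case: (index_cases i) => -[w ->]; have [imw | nimw] := boolP (im w).
  - case/codomP: imw => b ->.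
    rewrite -[X in ideal _ ((X - f X) * _)]/(xG (h b)) fE emb_outx emb_inx subrr mul0r.
    exact: ideal0.
  - rewrite -[X in ideal _ ((X - f X) * _)]/(xG w) fE emb_outx0 // rmorph0 subr0.
    by apply: (outer_minor _ _).1; apply: outer.
  - case/codomP: imw => b ->.
    rewrite -[X in ideal _ ((X - f X) * _)]/(yG (h b)) fE emb_outy emb_iny subrr mul0r.
    exact: ideal0.
  - rewrite -[X in ideal _ ((X - f X) * _)]/(yG w) fE emb_outy0 // rmorph0 subr0.
    by apply: (outer_minor _ _).2; apply: outer.
rewrite [f (minor _ _ _)]fE (emb_out_minor0 nim) rmorph0 mulr0 subr0; apply: idealM; apply: idealG.
by left; exists u, v; split=> //; move: uv; rewrite /complete_on (negPf nim) orbF.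
Qed.
End Embedding.
Section Completion.
Variables (k : fieldType) (H G : sgraph) (h : H -> G).
Hypothesis h_inj : injective h.
Local Notation NG := (#|G| + #|G|)%N.
Local Notation NH := (#|H| + #|H|)%N.
Local Notation iota := (emb_in k h).
Local Notation rho := (emb_out k h).
Local Notation im v := (v \in codom h).

Lemma kvanish_complete_on (e : rel G) (e' : rel H) d :
  (forall w u, ~~ im w -> im u -> e w u) -> (forall u v, e (h u) (h v) = e' u v) ->
  (1 < d)%N -> (forall i, qvanish (ideal (edge_gen k e')) i d) ->
  forall i, kvanish (vars k NG) (ifam (ideal (edge_gen k (complete_on h e))))
                    (ifam (ideal (edge_gen k e))) i d.
Proof.
move=> outer ee' d2 van.
have gI := @gmod_ifam k NG; have gIH := @gmod_ifam k NH.
pose K := edge_gen k (clique_rel [set: H]).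
have K_all u v : ideal K (minor k u v).
  by apply: idealG; left; exists u, v; rewrite /clique_rel !inE.
have sub_e q : edge_gen k e q -> ideal (edge_gen k (complete_on h e)) q.
  case=> [[u [v [uv ->]]] | [i []//]]; apply: idealG; left; exists u, v.
  by rewrite /complete_on uv.
have vanK i : kvanish (vars k NH) (ifam (ideal K)) (ifam (ideal (edge_gen k e'))) i d.
  case: d d2 van => // d d1 van.
  (* The clique enters one homological degree higher and one strand lower, and that strand must
     still be positive: hence [1 < d]. *)
  apply: (@kvanish_sub _ _ _ _ (@hfam k NH)) => //.
  - exact: gmod_hfam.
  - by apply: gincl_ifam => _ [[u [v [_ ->]]] | [j []//]].
  - by move=> j p [].
  - exact: van.
  - by apply: (@qvanish_clique k H [set: H] pred0 i.+1 d).
have rhoK p : ideal (edge_gen k (complete_on h e)) p -> ideal K (rho p).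
  by apply: emb_out_ideal => // u v _; rewrite /clique_rel !inE.
have iotaK p : ideal K p -> ideal (edge_gen k (complete_on h e)) (iota p).
  by apply: emb_in_ideal => u v _; rewrite /complete_on !codom_f orbT.
have iotaI p : ideal (edge_gen k e') p -> ideal (edge_gen k e) (iota p).
  by apply: emb_in_ideal => u v; rewrite ee'.
have rhoI p : ideal (edge_gen k e) p -> ideal (edge_gen k e') (rho p).
  by apply: emb_out_ideal => // u v; rewrite ee'.
move=> i; apply: kvanish_perm (outer_vars_perm k h_inj) _.
- exact: (gI _).1.
- exact: (gI _).1.
apply: kvanish_cat => [|| z zo d' p Ip|{}i].
- exact: (gI _).1.
- exact: (gI _).1.
- have z_var : z \in vars k NG by move: zo; rewrite mem_filter => /andP[].
  split; first by apply: (gmod_hfam k NG).2; case: Ip.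
  case: Ip => _ Ip.
  elim: Ip => [|c g {}p gg _ IH]; first by rewrite mulr0; apply: ideal0.
  rewrite mulrDr mulrCA; apply: idealD => //; apply: idealM.
  case: gg => [[u [v [/orP[uv|/andP[imu imv]] ->]]] | [j []//]].
    by apply: idealM; apply: idealG; left; exists u, v.
  have [w nimw [->|->]] := outer_varsP zo.
    by apply: (outer_minor k _ _).1; apply: outer.
  by apply: (outer_minor k _ _).2; apply: outer.
apply: (@kvanish_lift _ _ iota _ _ _ (ifam (ideal K)) (ifam (ideal (edge_gen k e')))).
- exact: (gI _).1.
- by move=> j p [hp Ip]; split; [apply: emb_in_homog | apply: iotaK].
- by move=> j p [hp Ip]; split; [apply: emb_in_homog | apply: iotaI].
- move=> j p [hp Ip]; exists (rho p), (p - iota (rho p)); split.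
  + by split; [apply: emb_out_homog | apply: rhoK].
  + split; last exact: complete_on_split.
    by apply: rpredB => //; apply: emb_in_homog; apply: emb_out_homog.
  + by rewrite addrC subrK.
- move=> j p [hp _] [_ Ip]; split=> //.
  by rewrite -[p](emb_inK h_inj); apply: rhoI.
- exact: gIH.
- split; first exact: (gI _).1.
  move=> z zin; apply: (gI _).2.
  by rewrite -(perm_mem (outer_vars_perm k h_inj)) mem_cat zin orbT.
- exact: vanK.
Qed.
End Completion.

Lemma connect_sym_sgraph (G : sgraph) : connect_sym (@edge G).
Proof. exact: sym_connect_sym (@edge_sym G). Qed.

(** * Completing the factors of a join *)

Section Join.
Variables (k : fieldType) (G : sgraph).
Local Notation N := (#|G| + #|G|)%N.

Lemma factor_edge (C : component (compl G)) (u v : join_factor C) :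
  edge u v = @edge G (val u) (val v).
Proof.
have [-> | uv] := eqVneq u v; first by rewrite !edge_irr.
have -> : edge u v = (u != v) && ~~ ((val u != val v) && ~~ @edge G (val u) (val v)) by [].
by rewrite (inj_eq val_inj) uv negbK.
Qed.

Definition complete_comps (l : seq (component (compl G))) : rel G :=
  fun u v => edge u v || has (fun C : component (compl G) => (u \in val C) && (v \in val C)) l.

Lemma component_mem (C : component (compl G)) u v :
  u \in val C -> (v \in val C) = connect (@edge (compl G)) u v.
Proof.
case: C => C /= /imsetP[w _ ->]; rewrite !in_set => wu.
exact: (same_connect (@connect_sym_sgraph (compl G)) wu).
Qed.

Lemma component_of (u : G) : exists C : component (compl G), u \in val C.
Proof.
pose D := [set v in [set: compl G] | connect (@edge (compl G)) u v].
have DC : D \in components (compl G) by apply/imsetP; exists u; rewrite ?inE.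
by exists (Sub D DC); rewrite SubK !inE connect0.
Qed.

Lemma component_uniq (C D : component (compl G)) u : u \in val C -> u \in val D -> C = D.
Proof.
move=> uC uD; apply: val_inj; apply/setP => v.
by rewrite (component_mem v uC) (component_mem v uD).
Qed.

Lemma component_outer (C : component (compl G)) (u w : G) :
  u \in val C -> w \notin val C -> @edge G w u.
Proof.
move=> uC wC; have : ~~ connect (@edge (compl G)) u w by rewrite -(component_mem w uC).
apply: contraR => wu; apply: connect1.
have -> : @edge (compl G) u w = (u != w) && ~~ @edge G u w by [].
apply/andP; split; first by apply: contraNneq wC => <-.
by rewrite (@edge_sym G u w).
Qed.

Lemma qvanish_join d : (1 < d)%N ->
  (forall (C : component (compl G)) i,
     qvanish (ideal (edge_gen k (@edge (join_factor C)))) i d) ->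
  forall i, qvanish (ideal (edge_gen k (@edge G))) i d.
Proof.
move=> d2 van i.
have gI := @gmod_ifam k N; have gh := gmod_hfam k N.
(* [m] lists the factors already completed and [l] those still to be completed. *)
have step l m : uniq (l ++ m) ->
    (forall i, qvanish (ideal (edge_gen k (complete_comps (catrev l m)))) i d) ->
    forall i, qvanish (ideal (edge_gen k (complete_comps m))) i d.
  elim: l m => [|C l IHl] m //= /andP[Cm uniq_lm] van_l {}i.
  pose h (u : join_factor C) : G := val u.
  have codomE v : (v \in codom h) = (v \in val C).
    apply/codomP/idP => [[u ->] | vC]; first exact: (valP u).
    by exists (Sub v vC); rewrite /h SubK.
  apply: (@kvanish_ext _ _ _ (ifam (ideal (edge_gen k (complete_on h (complete_comps m)))))).
  - exact: (gI _).1.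
  - exact: (gI _).1.
  - exact: gh.1.
  - apply: gincl_ifam => q [[u [v [uv ->]]]|[j []//]]; apply: idealG; left.
    by exists u, v; rewrite /complete_on uv.
  - by move=> j p [].
  - apply: (@kvanish_complete_on k (join_factor C) G h val_inj _ (@edge _) d _ _ d2 (van C)).
      move=> w u; rewrite !codomE => wC uC.
      by rewrite /complete_comps (component_outer uC wC).
    (* The factors in [m] are disjoint from [C], so the edges inside [C] are still those of its own
       graph. *)
    move=> u v; rewrite /complete_comps factor_edge orbC.
    case: hasP => // -[D Dm /andP[uD _]].
    by case/negP: Cm; rewrite mem_cat (component_uniq (valP u) uD) Dm orbT.
  - apply: qvanish_congr (IHl (C :: m) _ van_l i); last first.
      by rewrite uniq_catC /= mem_cat orbC -mem_cat Cm uniq_catC.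
    move=> p; split; apply: ideal_le => _ [[u [v [uv ->]]] | [j []//]]; apply: idealG; left;
    exists u, v; split=> //; move: uv; rewrite /complete_on /complete_comps /= !codomE;
    rewrite -!orbA [(_ && _) || has _ _]orbC //.
have E0 : qvanish (ideal (edge_gen k (complete_comps [::]))) i d.
  apply: (step (enum (component (compl G)))); first by rewrite cats0 enum_uniq.
  (* With all factors completed the graph is complete, since vertices of different factors are
     adjacent. *)
  move=> {}i; apply: qvanish_congr (@qvanish_clique k G [set: G] pred0 i d _ _) => //; last exact: ltnW.
  move=> p; split; apply: ideal_le => _ [[u [v [_ ->]]] | [j []//]]; apply: idealG; left;
  exists u, v; split=> //.
    rewrite /complete_comps; have [C uC] := component_of u.
    have [vC | vC] := boolP (v \in val C); last by rewrite edge_sym (component_outer uC vC).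
    by apply/orP; right; apply/hasP; exists C; rewrite ?uC // catrevE cats0 mem_rev mem_enum.
  by rewrite /clique_rel !inE.
apply: qvanish_congr E0 => p; split; apply: ideal_le => _ [[u [v [uv ->]]] | [j []//]];
  apply: idealG; left; exists u, v; split=> //; move: uv; by rewrite /complete_comps /= orbF.
Qed.
End Join.
(** * Induced paths *)

Section FourElements.
Variable R : comNzRingType.

Lemma kdiff_split z (s : seq R) i (v : 'rV_(krank (size s) i.+2 + krank (size s) i.+1)) :
  v *m kdiff (z :: s) i.+1 =
  row_mx (lsubmx v *m kdiff s i.+1 + z *: rsubmx v) (- (rsubmx v *m kdiff s i)).
Proof. by rewrite -{1}[v]hsubmxK kdiff_cons. Qed.

(* The coefficients of w in front of q r s, p r s, p q s and p q r are A, B, C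
   and E; only four of the six coefficients of the boundary are recorded. *)
Lemma kdiff4_boundary (p q r s F : R) (w : 'rV[R]_(krank 4 4)) :
  exists A B C E : R, forall J : R -> Prop,
  inrow J ((row_mx (row_mx 0 (row_mx 0 (row_mx F%:M 0))) 0 : 'rV[R]_(krank 4 3))
           - w *m kdiff [:: p; q; r; s] 3) ->
  [/\ J (F - (s * A + p * E)), J (r * A - p * C), J (r * B + q * C)
    & J (q * E - s * B)].
Proof.
rewrite (@kdiff_split p [:: q; r; s] 2).
move: (lsubmx w) (rsubmx w) => a b {w}.
rewrite (@kdiff_split q [:: r; s] 2) (@kdiff_split q [:: r; s] 1).
move: (lsubmx a) (rsubmx a) => a1 a2 {a}.
rewrite -[in p *: b](@hsubmxK _ _ (krank 2 3) (krank 2 2) b).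
move: (lsubmx b) (rsubmx b) => b1 b2 {b}.
rewrite !(@kdiff_split r [:: s] 1) (@kdiff_split r [:: s] 0).
rewrite -[in q *: b2](@hsubmxK _ _ (krank 1 2) (krank 1 1) b2).
rewrite -[in p *: row_mx b1 b2](@hsubmxK _ _ (krank 1 2) (krank 1 1) b2).
move: (lsubmx a2) (rsubmx a2) => a3 a4.
move: (lsubmx b1) (rsubmx b1) => b3 b4.
move: (lsubmx b2) (rsubmx b2) => c d {b2}.
rewrite !(@kdiff_split s [::] 0) [a3](rV_thin _ 0) // [b3](rV_thin _ 0) //.
have k0 i : kdiff [::] i = 0 :> 'M[R]_(krank 0 i.+1, krank 0 i) by [].
rewrite !k0 !mulmx0 !oppr0 !mul0mx !add0r.
pose o : 'I_(krank 0 1) := ord0.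
pose o12 : 'I_(krank 1 2) := rshift (krank 0 2) o.
pose o11 : 'I_(krank 1 1) := lshift (krank 0 0) o.
exists (a4 0 o12), (b4 0 o12), (c 0 o12), (d 0 o11) => J JV.
have aE m (A B : 'rV[R]_m) j : (A + B) 0 j = A 0 j + B 0 j by rewrite mxE.
have nE m (A : 'rV[R]_m) j : (- A) 0 j = - A 0 j by rewrite mxE.
have zE m x (A : 'rV[R]_m) j : (x *: A) 0 j = x * A 0 j by rewrite mxE.
have z0 m j : (0 : 'rV[R]_m) 0 j = 0 by rewrite mxE.
have FE : (F%:M : 'rV[R]_1) 0 o = F by rewrite mxE eqxx.
have rE (v : 'rV[R]_(krank 1 2)) : (@rsubmx _ 1 (krank 0 2) (krank 0 1) v) 0 o = v 0 o12.
  by rewrite mxE.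
split.
- have := JV (lshift (krank 3 2) (rshift (krank 2 3) (rshift (krank 1 2) o11))).
  by rewrite !(aE, nE, zE, row_mxEl, row_mxEr, z0) rE FE opprK.
- have := JV (lshift (krank 3 2) (rshift (krank 2 3) (lshift (krank 1 1) o12))).
  by rewrite !(aE, nE, zE, row_mxEl, row_mxEr, z0) add0r opprD opprK.
- have := JV (rshift (krank 3 3) (lshift (krank 2 1) (lshift (krank 1 1) o12))).
  by rewrite !(aE, nE, zE, row_mxEl, row_mxEr, z0) add0r opprK.
- have := JV (rshift (krank 3 3) (lshift (krank 2 1) (rshift (krank 1 2) o11))).
  by rewrite !(aE, nE, zE, row_mxEl, row_mxEr, z0) rE add0r opprK addrC.
Qed.

(** The row is [F] times the basis element [q r] of homological degree 2. *)
Lemma inrow4 (J : R -> Prop) (F : R) : subgroup J -> J F ->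
  inrow J (row_mx (row_mx 0 (row_mx 0 (row_mx F%:M 0))) 0 : 'rV[R]_(krank 4 3)).
Proof.
move=> sJ JF.
apply/(@inrow_row_mx _ _ (krank 3 3) (krank 3 2)); split; last exact: inrow0.
apply/(@inrow_row_mx _ _ (krank 2 3) (krank 2 2)); split; first exact: inrow0.
apply/(@inrow_row_mx _ _ (krank 1 2) (krank 1 1)); split; first exact: inrow0.
apply/(@inrow_row_mx _ _ (krank 0 1) (krank 0 0)); split; last exact: inrow0.
by move=> j; rewrite mxE ord1 eqxx.
Qed.

(** Up to sign, the only nonzero coefficients of the boundary of [F q r] are [q F] and [r F]. *)
Lemma kdiff4_cycle (J : R -> Prop) (p q r s F : R) :
  subgroup J -> J (q * F) -> J (r * F) ->
  inrow J ((row_mx (row_mx 0 (row_mx 0 (row_mx F%:M 0))) 0 : 'rV[R]_(krank 4 3))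
           *m kdiff [:: p; q; r; s] 2).
Proof.
move=> sJ JqF JrF.
have i0 m : inrow J (0 : 'rV[R]_m) by apply: inrow0.
rewrite (@kdiff_split p [:: q; r; s] 1) row_mxKl row_mxKr scaler0 addr0 mul0mx oppr0.
apply/inrow_row_mx; split; last exact: i0.
rewrite (@kdiff_split q [:: r; s] 1) row_mxKl row_mxKr mul0mx add0r.
apply/inrow_row_mx; split.
  rewrite scale_row_mx scaler0; apply/(@inrow_row_mx _ _ (krank 1 2) (krank 1 1)); split; first exact: i0.
  rewrite scale_row_mx scaler0; apply/(@inrow_row_mx _ _ (krank 0 1) (krank 0 0)); split; last exact: i0.
  by move=> j; rewrite !mxE ord1 eqxx.
apply: inrowN => //; rewrite (@kdiff_split r [:: s] 0) row_mxKl row_mxKr mul0mx add0r.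
apply/inrow_row_mx; split; last by rewrite kdiff0 mulmx0 oppr0; apply: i0.
rewrite scale_row_mx scaler0; apply/(@inrow_row_mx _ _ (krank 0 1) (krank 0 0)); split; last exact: i0.
by move=> j; rewrite !mxE ord1 eqxx.
Qed.
End FourElements.

Section FourVariables.
Variable k : fieldType.
Local Notation S := {mpoly k[4]}.
Local Notation v0 := (@Ordinal 4 0 isT).
Local Notation v1 := (@Ordinal 4 1 isT).
Local Notation v2 := (@Ordinal 4 2 isT).
Local Notation v3 := (@Ordinal 4 3 isT).

(** For an induced path [u w v] these are the images of its two minors when only
    [x_u, y_w, x_w, y_v] are kept, as [X_0, ..., X_3]. They form a complete intersection, whose
    [Tor_2] lies in degree 4, that is in strand 1. *)
Definition two_quadrics (x : S) : Prop := x = 'X_v0 * 'X_v1 \/ x = 'X_v2 * 'X_v3.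

Lemma mcoeff_mulX n (i : 'I_n) (p : {mpoly k[n]}) (m : 'X_{1..n}) : ('X_i * p)@_(U_(i) + m) = p@_m.
Proof. by rewrite mulrC mcoeffMX. Qed.

Lemma mcoeff_mulX0 n (i : 'I_n) (p : {mpoly k[n]}) (m : 'X_{1..n}) : m i = 0%N -> ('X_i * p)@_m = 0.
Proof.
move=> mi; apply/eqP; rewrite mcoeff_eq0 mulrC (perm_mem (msuppMX _ _)).
apply/mapP => -[m' _ mE]; move: mi; rewrite mE mnmDE mnm1E eqxx.
by [].
Qed.

Lemma two_quadrics_coef (p : S) (i j : 'I_4) :
  (i == v0) || (i == v1) -> (j == v2) || (j == v3) ->
  ideal two_quadrics p -> p@_(U_(i) + U_(j))%MM = 0.
Proof.
move=> hi hj; elim=> [|c x {}p gx _ IH]; first by rewrite mcoeff0.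
rewrite mcoeffD IH addr0.
have E a (q : S) : (U_(i) + U_(j))%MM a = 0%N -> (c * ('X_a * q))@_(U_(i) + U_(j))%MM = 0.
  by move=> a0; rewrite mulrCA mcoeff_mulX0.
case: gx => ->.
  case/orP: hi => /eqP iE; last by apply: E; rewrite mnmDE !mnm1E iE; case/orP: hj => /eqP ->.
  by rewrite ['X_v0 * _]mulrC; apply: E; rewrite mnmDE !mnm1E iE; case/orP: hj => /eqP ->.
case/orP: hj => /eqP jE; last by apply: E; rewrite mnmDE !mnm1E jE; case/orP: hi => /eqP ->.
by rewrite ['X_v2 * _]mulrC; apply: E; rewrite mnmDE !mnm1E jE; case/orP: hi => /eqP ->.
Qed.

(** With indices for linear coefficients, comparison at [X_0 X_3], [X_0 X_2], [X_1 X_2] and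
    [X_1 X_3] gives [A_0 + E_3 = 1], [A_0 = C_2], [B_1 + C_2 = 0] and [E_3 = B_1], hence [1 = 0]. *)
Lemma two_quadrics_syzygy (A B C E : S) :
  ideal two_quadrics ('X_v0 * 'X_v3 - ('X_v3 * A + 'X_v0 * E)) ->
  ideal two_quadrics ('X_v2 * A - 'X_v0 * C) ->
  ideal two_quadrics ('X_v2 * B + 'X_v1 * C) ->
  ideal two_quadrics ('X_v1 * E - 'X_v3 * B) -> False.
Proof.
move=> /(two_quadrics_coef (i := v0) (j := v3) isT isT) h03.
move=> /(two_quadrics_coef (i := v0) (j := v2) isT isT) h02.
move=> /(two_quadrics_coef (i := v1) (j := v2) isT isT) h12.
move=> /(two_quadrics_coef (i := v1) (j := v3) isT isT) h13.
have cl (i j : 'I_4) (p : S) : ('X_i * p)@_(U_(i) + U_(j)) = p@_U_(j) by apply: mcoeff_mulX.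
have cr (i j : 'I_4) (p : S) : ('X_j * p)@_(U_(i) + U_(j)) = p@_U_(i).
  by rewrite [(U_(i) + _)%MM]addmC; apply: mcoeff_mulX.
move: h03 h02 h12 h13; rewrite !(mcoeffB, mcoeffD) !(cl, cr).
rewrite mcoeffX eqxx => h03 h02 h12 h13.
have : (true%:R : k) = 0; last by move/eqP; rewrite oner_eq0.
move/subr0_eq: h03 => ->; move/subr0_eq: h02 => ->; move/subr0_eq: h13 => ->.
by rewrite addrC.
Qed.
End FourVariables.

Section InducedPath.
Variables (k : fieldType) (G : sgraph) (u w v : G).
Hypotheses (uw : edge u w) (wv : edge w v) (neq_uv : u != v) (nuv : ~~ edge u v).
Local Notation N := (#|G| + #|G|)%N.
Local Notation S := {mpoly k[N]}.
Local Notation x := (@xvar k G).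
Local Notation y := (@yvar k G).
Local Notation v0 := (@Ordinal 4 0 isT).
Local Notation v1 := (@Ordinal 4 1 isT).
Local Notation v2 := (@Ordinal 4 2 isT).
Local Notation v3 := (@Ordinal 4 3 isT).

Definition path_map : {rmorphism S -> {mpoly k[4]}} :=
  bsub (fun a => if a == u then 'X_v0 else if a == w then 'X_v2 else 0)
       (fun a => if a == w then 'X_v1 else if a == v then 'X_v3 else 0).

Lemma path_mapx a : path_map (x a) = if a == u then 'X_v0 else if a == w then 'X_v2 else 0.
Proof. exact: bsubx. Qed.

Lemma path_mapy a : path_map (y a) = if a == w then 'X_v1 else if a == v then 'X_v3 else 0.
Proof. exact: bsuby. Qed.

Lemma path_map_homog d p : p \is d.-homog -> path_map p \is d.-homog.
Proof.
by apply: bsub_homog => a; do 2![case: ifP => _; first exact: homogX]; apply: dhomog0.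
Qed.

Let neq_uw : u != w. Proof. by apply: contraTneq uw => ->; rewrite edge_irr. Qed.
Let neq_wv : w != v. Proof. by apply: contraTneq wv => ->; rewrite edge_irr. Qed.

Lemma path_map_ideal p : ideal (edge_gen k (@edge G)) p ->
  ideal (@two_quadrics k) (path_map p).
Proof.
apply: ideal_map => _ [[a [b [ab ->]]] | [i []//]].
have I1 : ideal (@two_quadrics k) ('X_v0 * 'X_v1) by apply: idealG; left.
have I2 : ideal (@two_quadrics k) ('X_v2 * 'X_v3) by apply: idealG; right.
have xu : path_map (x u) = 'X_v0 by rewrite path_mapx eqxx.
have yu : path_map (y u) = 0 by rewrite path_mapy (negPf neq_uw) (negPf neq_uv).
have xw : path_map (x w) = 'X_v2 by rewrite path_mapx eq_sym (negPf neq_uw) eqxx.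
have yw : path_map (y w) = 'X_v1 by rewrite path_mapy eqxx.
have xv : path_map (x v) = 0.
  by rewrite path_mapx eq_sym (negPf neq_uv) eq_sym (negPf neq_wv).
have yv : path_map (y v) = 'X_v3 by rewrite path_mapy eq_sym (negPf neq_wv) eqxx.
have cases c : [\/ c = u, c = w, c = v | path_map (x c) = 0 /\ path_map (y c) = 0].
  rewrite path_mapx path_mapy; case: eqVneq => [-> | _]; first by constructor.
  case: eqVneq => [-> | _]; first by constructor.
  by case: eqVneq => [-> | _]; constructor.
have nvu : edge v u = false by rewrite edge_sym (negPf nuv).
rewrite minorE; case: (cases a) ab => [->|->|->|[-> ->]] ab;
  rewrite ?xu ?yu ?xw ?yw ?xv ?yv;
  case: (cases b) ab => [->|->|->|[-> ->]] ab;
  rewrite ?xu ?yu ?xw ?yw ?xv ?yv ?(mul0r, mulr0, subr0, sub0r, subrr, oppr0);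
  try exact: ideal0; try exact: I1; try exact: I2; try by rewrite ?nvu ?(negPf nuv) in ab.
- by rewrite mulrC; apply: idealN.
- by rewrite mulrC subrr; apply: ideal0.
- by rewrite mulrC; apply: idealN.
Qed.

Let four : seq S := [:: x u; y w; x w; y v].

Lemma four_vars_perm : perm_eq ([seq z <- vars k N | z \notin four] ++ four) (vars k N).
Proof.
have four_uniq : uniq four.
  have xI : injective x by move=> a b /mpolyX_var_inj/ix_inj.
  have yI : injective y by move=> a b /mpolyX_var_inj/iy_inj.
  have xy a b : (x a == y b) = false.
    by rewrite /xvar /yvar (inj_eq (@mpolyX_var_inj k N)) eq_lrshift.
  rewrite /= !inE !xy ![y w == x _]eq_sym ![x _ == y _]xy (inj_eq xI) (inj_eq yI).
  by rewrite (negPf neq_uw) (negPf neq_wv).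
have four_var z : z \in four -> z \in vars k N.
  by rewrite !inE => /or4P[]/eqP->; apply: mem_vars.
apply: uniq_perm; last 2 first.
- exact: vars_uniq.
- move=> z; rewrite mem_cat mem_filter; case: (boolP (z \in four)) => //= [/four_var -> | _] //.
  by rewrite orbF.
rewrite cat_uniq filter_uniq ?vars_uniq // four_uniq andbT andTb.
by apply/hasPn => z zin; rewrite mem_filter zin.
Qed.

(* The cycle is f_uv dy_w dx_w. *)
Lemma not_qvanish_path : ~ qvanish (ideal (edge_gen k (@edge G))) 2 1.
Proof.
have gI := @gmod_ifam k N; have gh := gmod_hfam k N.
have p4 : perm_eq (vars k N) ([seq z <- vars k N | z \notin four] ++ four).
  by rewrite perm_sym; apply: four_vars_perm.
move=> /(kvanish_perm gh.1 (gI _).1 p4).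
have hD d p : ifam (ideal (edge_gen k (@edge G))) d p ->
    ifam (ideal (@two_quadrics k)) d (path_map p).
  by case=> hp Ip; split; [apply: path_map_homog | apply: path_map_ideal].
have hH d p : @hfam k N d p -> @hfam k 4 d (path_map p) by apply: path_map_homog.
move=> /(kvanish_mapW hH hD)/(kvanish_map_drop gh.1 (gI _).1).
have out z : z \in [seq z <- vars k N | z \notin four] -> path_map z = 0.
  rewrite mem_filter !inE !negb_or => /andP[/and4P[zxu zyw zxw zyv] /mapP[i _ zE]].
  move: zxu zyw zxw zyv; rewrite {z}zE; case: (index_cases i) => -[a ->] xu yw xw yv.
    rewrite [LHS]path_mapx; case: eqVneq => [au | _]; first by rewrite au eqxx in xu.
    by case: eqVneq => [aw | _] //; rewrite aw eqxx in xw.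
  rewrite [LHS]path_mapy; case: eqVneq => [aw | _]; first by rewrite aw eqxx in yw.
  by case: eqVneq => [av | _] //; rewrite av eqxx in yv.
move=> /(_ out) van.
pose f := minor k u v.
(* The vertex [w] is adjacent to [u] and [v], so [x_w] and [y_w] carry [f] into the edge ideal;
   these two products are the coefficients of the boundary. *)
have [Ixf Iyf] := outer_minor k (etrans (edge_sym _ _) uw) wv.
have [||W [_ IW]] := van (row_mx (row_mx 0 (row_mx 0 (row_mx (f%:M : 'M_1) 0))) 0).
- by apply: inrow4; [apply: gh.1 | apply: minor_homog].
- apply: kdiff4_cycle; first exact: (gI _).1.
    split=> //; apply: (dhomogM (yvar_homog k w) (minor_homog k u v)).
  split=> //; apply: (dhomogM (xvar_homog k w) (minor_homog k u v)).
have fourE : path_map \o nth 0 four =1 nth 0 [:: 'X_v0; 'X_v1; 'X_v2; 'X_v3].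
  case=> [|[|[|[|j]]]] /=.
  - by rewrite path_mapx eqxx.
  - by rewrite path_mapy eqxx.
  - by rewrite path_mapx eq_sym (negPf neq_uw) eqxx.
  - by rewrite path_mapy eq_sym (negPf neq_wv) eqxx.
  - by rewrite !nth_nil rmorph0.
have fE : path_map f = 'X_v0 * 'X_v3.
  rewrite minorE !path_mapx !path_mapy eqxx (negPf neq_uw) (negPf neq_uv).
  by rewrite eq_sym (negPf neq_wv) eqxx mul0r subr0.
have [A [B [C [E /(_ (ifam (ideal (@two_quadrics k)) 2))]]]] :=
  kdiff4_boundary 'X_v0 'X_v1 'X_v2 'X_v3 (path_map f) W.
case.
  move: IW; rewrite !map_row_mx !map_mx0 map_scalar_mx.
  by rewrite (eq_kdiff _ _ fourE).
rewrite fE => -[_ J1] [_ J2] [_ J3] [_ J4].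
exact: (two_quadrics_syzygy J1 J2 J3 J4).
Qed.
End InducedPath.
(** * Cographs *)

Section Seinsche.
Variable T : finType.
Implicit Types (e : rel T) (A : {set T}).

Definition P4_free e := forall s t v y, uniq [:: s; t; v; y] ->
  e s t -> e t v -> e v y -> ~~ e s v -> ~~ e s y -> ~~ e t y -> False.

Definition restr e A : rel T := fun u v => [&& u \in A, v \in A & e u v].
Definition conn e A := forall u v, u \in A -> v \in A -> connect (restr e A) u v.
Definition corel e : rel T := fun u v => (u != v) && ~~ e u v.

Definition sgr e := (forall u v, e u v = e v u) /\ forall u, e u u = false.

Lemma corel_sgr e : sgr e -> sgr (corel e).
Proof.
by case=> e_sym _; split=> [u v | u]; rewrite /corel ?eqxx // eq_sym e_sym.
Qed.

Lemma corelK e : sgr e -> corel (corel e) =2 e.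
Proof.
case=> _ e_irr u v; rewrite /corel negb_and !negbK.
by have [-> | _] := eqVneq u v; rewrite ?e_irr.
Qed.

(** The path on four vertices is self-complementary: the complement of [s t v y] is the path
    [t y s v]. *)
Lemma corel_P4_free e : sgr e -> P4_free e -> P4_free (corel e).
Proof.
move=> [e_sym _] p4 s t v y st4; rewrite /corel.
have := st4; rewrite /= !inE !negb_or => /and4P[/and3P[st sv sy] /andP[tv ty] vy _].
rewrite st sv sy tv ty vy /= !negbK => est etv evy esv esy ety.
apply: (p4 t y s v); rewrite ?ety ?esv ?(e_sym t s) ?(e_sym y v) //; last by rewrite e_sym.
by rewrite /= !inE !negb_or [t == s]eq_sym [y == s]eq_sym [y == v]eq_sym st sv sy tv ty vy.
Qed.

Lemma restr_sym e A : sgr e -> connect_sym (restr e A).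
Proof.
case=> e_sym _; apply: sym_connect_sym => u v.
by rewrite /restr e_sym andbCA.
Qed.

Lemma conn_neighbour e A u v : conn e A -> u \in A -> v \in A -> u != v ->
  exists2 w, w \in A & e u w.
Proof.
move=> ce uA vA uv; have /connectP[[|w p] /=] := ce u v uA vA.
  by move=> _ vE; rewrite vE eqxx in uv.
by case/andP => /and3P[_ wA uw] _ _; exists w.
Qed.

(** The walk is stopped just before its first visit to [v]. *)
Lemma conn_last_step e A v z : z \in A :\ v -> connect (restr e A) z v ->
  exists c, [/\ c \in A :\ v, connect (restr e (A :\ v)) z c & e c v].
Proof.
move=> zA /connectP[p zp vE]; elim: p z zA zp vE => [|a p IHp] z zA /=.
  by move=> _ vE; rewrite -vE !inE eqxx in zA.
case/andP=> /and3P[_ aA za] ap vE; have [av | av] := eqVneq a v.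
  by exists z; split; rewrite ?connect0 // -av.
have aA' : a \in A :\ v by rewrite !inE av.
have [c [cA ac cv]] := IHp a aA' ap vE; exists c; split=> //.
by apply: connect_trans ac; apply: connect1; rewrite /restr zA aA'.
Qed.

Lemma conn_flip e A (P : pred T) x c : ~~ P x -> P c -> connect (restr e A) x c ->
  exists s t, [/\ connect (restr e A) x s, restr e A s t, ~~ P s & P t].
Proof.
move=> nPx Pc /connectP[p xp cE]; elim: p x nPx xp cE => [|a p IHp] x nPx /=.
  by move=> _ cE; rewrite -cE Pc in nPx.
case/andP=> xa ap cE; have [Pa | nPa] := boolP (P a).
  by exists x, a; rewrite connect0.
have [s [t [as_ st ns Pt]]] := IHp a nPa ap cE; exists s, t; split=> //.
exact: connect_trans (connect1 xa) as_.
Qed.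

(* An edge s t of one component of A \ v with v adjacent to t only, and a
   neighbour y of v in another component, give the induced path s t v y. *)
Lemma conn_delete e A v : sgr e -> P4_free e -> v \in A ->
  conn e A -> conn (corel e) A -> conn e (A :\ v).
Proof.
move=> se p4 vA ce cce a b aA bA; apply: contraT => nab.
have csym := restr_sym (A :\ v) se.
have inA z : z \in A :\ v -> z \in A by rewrite inE => /andP[].
have neqv z : z \in A :\ v -> z != v by rewrite !inE => /andP[].
have va : v != a by rewrite eq_sym neqv.
have [x xA /andP[vx nvx]] := conn_neighbour cce vA (inA _ aA) va.
have xA' : x \in A :\ v by rewrite !inE eq_sym vx.
have [y0 y0A nxy0] : exists2 y0, y0 \in A :\ v & ~~ connect (restr e (A :\ v)) x y0.
  have [xa | nxa] := boolP (connect (restr e (A :\ v)) x a); last by exists a.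
  exists b => //; apply: contra nab => xb.
  by apply: connect_trans xb; rewrite csym.
have [c [cA xc cv]] := conn_last_step xA' (ce x v (inA _ xA') vA).
have [y [yA y0y yv]] := conn_last_step y0A (ce y0 v (inA _ y0A) vA).
have nxy : ~~ connect (restr e (A :\ v)) x y.
  by apply: contra nxy0 => xy; apply: connect_trans xy _; rewrite csym.
have nPx : ~~ e x v by rewrite se.1.
have [s [t [xs st ns et]]] := @conn_flip e _ (fun z => e z v) x c nPx cv xc.
have xt := connect_trans xs (connect1 st).
have [sA tA est] := and3P st.
have nclose z : connect (restr e (A :\ v)) x z -> z \in A :\ v -> (z != y) /\ ~~ e z y.
  move=> xz zA; split; first by apply: contraNneq nxy => <-.
  apply: contra nxy => zy; apply: connect_trans xz _; apply: connect1.
  by rewrite /restr zA yA.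
have [sy nsy] := nclose s xs sA; have [ty nty] := nclose t xt tA.
case: (p4 s t v y) => //; last by rewrite se.1.
rewrite /= !inE !negb_or sy ty (neqv s sA) (neqv t tA) [v == y]eq_sym (neqv y yA) !andbT.
by apply: contraTneq est => ->; rewrite se.2.
Qed.

Lemma eq_conn e e' A : e =2 e' -> conn e A -> conn e' A.
Proof.
move=> ee' ce u v uA vA; rewrite -(@eq_connect _ (restr e A)) ?ce //.
by move=> x y; rewrite /restr ee'.
Qed.

(** Deleting a vertex keeps both the graph and its complement connected, so a counterexample shrinks
    to two vertices, which would have to be both adjacent and non-adjacent. *)
Lemma seinsche e A : sgr e -> P4_free e -> (1 < #|A|)%N ->
  conn e A -> conn (corel e) A -> False.
Proof.
move=> se p4; have [m] := ubnP #|A|; elim: m A => // m IHm A lt_m A1 ce cce.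
have [v [u [vA uA vu]]] := card_gt1P A1.
have ce' : conn e (A :\ v) by apply: conn_delete.
have cce' : conn (corel e) (A :\ v).
  apply: conn_delete => //; [exact: corel_sgr | exact: corel_P4_free |].
  by apply: eq_conn ce => x y; rewrite corelK.
have cardA := cardsD1 v A; rewrite vA add1n in cardA.
have [A'1 | A'1] := ltnP 1 #|A :\ v|.
  by apply: IHm ce' cce' => //; rewrite cardA ltnS in lt_m.
have uniq_u w : w \in A -> w != v -> w = u.
  move=> wA wv; apply: (card_le1_eqP A'1); rewrite !inE ?wv //.
  by rewrite eq_sym vu.
have [w wA vw] := conn_neighbour ce vA uA vu.
have [w' w'A /andP[vw' nvw']] := conn_neighbour cce vA uA vu.
have wv : w != v by apply: contraTneq vw => ->; rewrite se.2.
by rewrite (uniq_u w' w'A) ?(eq_sym w') // -(uniq_u w wA wv) vw in nvw'.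
Qed.
End Seinsche.

Lemma cograph_P4_free (G : sgraph) : cograph G -> P4_free (@edge G).
Proof.
move=> cG s t v y st4 est etv evy nsv nsy nty; apply: cG.
exists (fun i : 'I_4 => nth s [:: s; t; v; y] i); split.
  by move=> i j /eqP; rewrite nth_uniq // => /eqP/val_inj.
have sym := @edge_sym G; have irr := @edge_irr G.
have F a b : ~~ @edge G a b -> (edge a b = false) * (edge b a = false).
  by move=> /negPf nab; rewrite [edge b a]sym nab.
have E a b : @edge G a b -> (edge a b) * (edge b a) by move=> ab; rewrite [edge b a]sym ab.
case=> [[|[|[|[|i]]]] ?] [[|[|[|[|j]]]] ?] //=;
  by rewrite ?irr ?(E _ _ est) ?(E _ _ etv) ?(E _ _ evy) ?(F _ _ nsv) ?(F _ _ nsy) ?(F _ _ nty).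
Qed.

Lemma edge_sgr (G : sgraph) : sgr (@edge G).
Proof. by split; [apply: edge_sym | apply: edge_irr]. Qed.

(** * The factors of a cograph *)

Section Factors.
Variable G : sgraph.
Implicit Types (C : component (compl G)).

Lemma factor_cograph C : cograph G -> cograph (join_factor C).
Proof.
move=> cG [f [f_inj fE]]; apply: cG; exists (fun i => val (f i)); split.
  by move=> i j /val_inj/f_inj.
by move=> i j; rewrite -factor_edge.
Qed.

(** A walk in the complement of the whole graph never leaves its component. *)
Lemma factor_coconnected C (u v : join_factor C) :
  connect (@edge (compl (join_factor C))) u v.
Proof.
have : connect (@edge (compl G)) (val u) (val v).
  by rewrite -(component_mem _ (valP u)) (valP v).
case/connectP => p; elim: p u => [|a p IHp] u /=.
  by move=> _ /val_inj ->; apply: connect0.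
case/andP=> ua ap vE; have aC : a \in val C.
  by rewrite (component_mem a (valP u)); apply: connect1.
apply: connect_trans (IHp (Sub a aC) ap vE); apply: connect1.
have -> : @edge (compl (join_factor C)) u (Sub a aC) =
  (u != Sub a aC) && ~~ @edge (join_factor C) u (Sub a aC) by [].
have /andP[neq_ua nua] : (val u != a) && ~~ @edge G (val u) a by [].
by apply/andP; split; [apply: contraNneq neq_ua => -> | rewrite factor_edge].
Qed.

Lemma factor_disconnected C : cograph G ->
  ~ connected (join_factor C) \/ #|join_factor C| = 1%N.
Proof.
move=> cG; apply: NNPP => /not_or_and[/NNPP[card_gt0 conH] card_neq1].
apply: (@seinsche (join_factor C) (@edge _) [set: join_factor C]).
- exact: edge_sgr.
- by apply: cograph_P4_free; apply: factor_cograph.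
- by rewrite cardsT ltn_neqAle eq_sym card_gt0 andbT; apply/eqP.
- move=> u v _ _; rewrite (@eq_connect _ _ (@edge _)) //.
  by move=> x y; rewrite /restr !inE.
- move=> u v _ _; rewrite (@eq_connect _ _ (@edge (compl (join_factor C)))).
    exact: factor_coconnected.
  by move=> x y; rewrite /restr !inE.
Qed.

Lemma component_ofW (v : G) : {C : component (compl G) | v \in val C}.
Proof. exact: sigW (component_of v). Qed.

Local Notation in_factor := (@Tagged _ _ (fun C => vertex (join_factor C))).

Definition to_join (v : G) : join (@join_factor G) :=
  in_factor (Sub v (svalP (component_ofW v))).

Lemma to_joinE C (u : join_factor C) :
  to_join (val u) = in_factor u.
Proof.
rewrite /to_join; case: (component_ofW _) => D /= uD.
have DC := component_uniq uD (valP u); case: _ / DC u uD => u uD.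
by congr Tagged; apply: val_inj.
Qed.

Lemma isomorphic_join : isomorphic G (join (@join_factor G)).
Proof.
exists to_join; split.
  exists (fun t : join (@join_factor G) => val (tagged t)) => [v | [C u]].
    by [].
  exact: to_joinE.
move=> u v; have edgeE a b : @edge (join (@join_factor G)) a b =
  (tag a != tag b) || edge (tagged a) (tagged_as a b) by [].
have uC := svalP (component_ofW u); move: (sval _) uC => C uC.
pose u' : join_factor C := Sub u uC.
have -> : to_join u = in_factor u' := to_joinE u'.
have [vC | vC] := boolP (v \in val C).
  pose v' : join_factor C := Sub v vC.
  have -> : to_join v = in_factor v' := to_joinE v'.
  rewrite -[RHS](factor_edge u' v').
  transitivity ((C != C) || edge u' (tagged_as (in_factor u') (in_factor v'))) => //.
  by rewrite eqxx tagged_asE.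
rewrite edgeE [RHS]edge_sym (component_outer uC vC); apply/orP; left => /=.
apply: contraNneq vC => ->; exact: (svalP (component_ofW v)).
Qed.
End Factors.

(** Without an induced path on three vertices, being equal or adjacent propagates along walks. *)
Lemma induced_path_exists (G : sgraph) : connected G -> ~ complete G ->
  exists u w v : G, [/\ edge u w, edge w v, u != v & ~~ edge u v].
Proof.
case=> _ conG nG; apply: NNPP => nopath; apply: nG => u v uv.
have /connectP[p up vE] := conG u v.
suff : (u == v) || edge u v by rewrite (negPf uv).
elim: p u {uv} up vE => [|a p IHp] u /=; first by move=> _ ->; rewrite eqxx.
case/andP=> ua ap /(IHp _ ap)/orP[/eqP <- | av]; first by rewrite ua orbT.
apply: contraT; rewrite negb_or => /andP[uv nuv]; case: nopath.
by exists u, a, v.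
Qed.

(** * The regularity of the join *)

Section Regularity.
Variable k : fieldType.
Implicit Types (G : sgraph).

Lemma edge_ideal_proper G : ~ ideal (edge_gen k (@edge G)) 1.
Proof.
have I0 p : ideal (edge_gen k (@edge G)) p -> msub (@kill k _ predT) p = 0.
  elim=> [|c q {}p [[u [v [_ ->]]] | [i []//]] _ IH]; first by rewrite rmorph0.
  by rewrite rmorphD rmorphM IH minorE !msubX /kill /= !mul0r subrr mulr0 addr0.
by move/I0/eqP; rewrite rmorph1 oner_eq0.
Qed.

(** [regularity] takes a predicate as argument, so the pointwise equivalence of the two ideals is
    turned into an equality by extensionality. *)
Lemma reg_bei_ideal G r :
  regularity (ideal (edge_gen k (@edge G))) r -> reg_bei k G r.
Proof.
suff <- : @bei k G = ideal (edge_gen k (@edge G)) by [].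
apply: functional_extensionality => p; apply: propositional_extensionality.
exact: bei_ideal.
Qed.
End Regularity.
(** [reg_bei] is a relation between a graph and a number, so the existence of the regularities [r C]
    is part of the claim. *)
Theorem proposition2p6 (k : fieldType) (G : sgraph) :
  connected G -> cograph G -> ~ complete G ->
  [/\ isomorphic G (join (@join_factor G)),
      forall C : component (compl G),
        cograph (join_factor C) /\
        (~ connected (join_factor C) \/ #|join_factor C| = 1%N)
    & exists r : component (compl G) -> nat,
        (forall C, reg_bei k (join_factor C) (r C)) /\
        reg_bei k G (maxn 2 (\max_C r C))].
Proof.
move=> conG cG nG; split; first exact: isomorphic_join.
  by move=> C; split; [apply: factor_cograph | apply: factor_disconnected].
pose I (H : sgraph) := ideal (edge_gen k (@edge H)).
have regP (H : sgraph) : exists r, [/\ regularity (I H) r,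
    forall i e, (r <= e)%N -> qvanish (I H) i e &
    r = 0%N \/ exists i, ~ qvanish (I H) i r.-1].
  have [D van] := regularity_finite (edge_gen k (@edge H)).
  exact: regularity_exists (@edge_ideal_proper k H) van.
have /fin_all_exists[r rP] (C : component (compl G)) := regP (join_factor C).
exists r; split=> [C|]; first by apply: reg_bei_ideal; case: (rP C).
apply: reg_bei_ideal; apply: regularity_intro.
- exact: edge_ideal_proper.
- move=> i e; rewrite geq_max => /andP[e2 /bigmax_leqP le_e].
  apply: qvanish_join e2 _ i => C i; case: (rP C) => _ van _.
  by apply: van; apply: le_e.
(* If no factor exceeds 2, the maximum is 2 and an induced path gives a class in strand 1. Otherwise
   some factor attains the maximum, and its nonvanishing strand passes to [G]. *)
right; have [le2 | gt2] := leqP (\max_C r C) 2.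
  exists 2%N.
  have [u [w [v [uw wv uv nuv]]]] := induced_path_exists conG nG.
  exact: not_qvanish_path uw wv uv nuv.
have card_gt0 : (0 < #|component (compl G)|)%N.
  case: conG => /card_gt0P[v _] _; have [C _] := component_of v.
  by apply/card_gt0P; exists C.
have [C maxE] := bigop.eq_bigmax r card_gt0.
rewrite maxE in gt2 *.
case: (rP C) => _ _ [r0 | [i nv]]; first by rewrite r0 in gt2.
exists i => van; apply: nv.
apply: (@qvanish_induced k (join_factor C) G (fun u => val u) val_inj _ _ _ _ _ van).
by move=> u v; rewrite factor_edge.
Qed.
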